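(* For every $\varepsilon > 0$ there exists $\delta > 0$ such that the following holds for every sufficiently large $n$. If $G$ is a red-blue colouring of the edges of $K_n$ in which both the graph of red edges and the graph of blue edges are $\varepsilon n^2$-far from bipartite, then $G$ contains a collection of at least $n^2/12 + \delta n^2$ pairwise edge-disjoint monochromatic triangles.
   Context: A graph is $k$-close to bipartite if it can be made bipartite by removing at most $k$ edges; otherwise it is $k$-far from bipartite. A triangle is monochromatic if its three edges have the same colour; triangles are edge-disjoint if they share no edge. *)

(* Defs.v *)
From HB Require Import structures.
From mathcomp Require Import all_boot all_order all_algebra.
From mathcomp Require Export reals.
Set Implicit Arguments. Unset Strict Implicit. Unset Printing Implicit Defensive.
Import Order.TTheory GRing.Theory Num.Theory.
Local Open Scope ring_scope.

(* A graph on a finite vertex type T is given by its edge set: a set of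
   2-element subsets of T. *)

Definition edges_of (T : finType) (t : {set T}) : {set {set T}} :=
  [set e in powerset t | #|e| == 2]%N.

Definition bipartite (T : finType) (E : {set {set T}}) : Prop :=
  exists f : T -> bool, forall e, e \in E ->
    forall x y, x \in e -> y \in e -> x != y -> f x != f y.

Definition close_to_bipartite (R : realType) (T : finType) (k : R)
  (E : {set {set T}}) : Prop :=
  exists F : {set {set T}}, [/\ F \subset E, (#|E :\: F|%:R <= k) & bipartite F].

Definition far_from_bipartite (R : realType) (T : finType) (k : R)
  (E : {set {set T}}) : Prop := ~ close_to_bipartite k E.

Definition red_graph (T : finType) (c : {set T} -> bool) : {set {set T}} :=
  [set e : {set T} | (#|e| == 2)%N && c e].
Definition blue_graph (T : finType) (c : {set T} -> bool) : {set {set T}} :=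
  [set e : {set T} | (#|e| == 2)%N && ~~ c e].

Definition mono_triangle (T : finType) (c : {set T} -> bool) (t : {set T}) : bool :=
  (#|t| == 3)%N &&
  ([forall e in edges_of t, c e] || [forall e in edges_of t, ~~ c e]).

Definition edge_disjoint (T : finType) (t1 t2 : {set T}) : bool :=
  [disjoint edges_of t1 & edges_of t2].

(* Main.v *)
From Stdlib Require Import ZArith.
Require Import Defs.
From HB Require Import structures.
From mathcomp Require Import all_boot all_order all_algebra.
From mathcomp Require Import reals.
From mathcomp Require Import ssrZ zify ring lra.
Set Implicit Arguments. Unset Strict Implicit. Unset Printing Implicit Defensive.
Import Order.TTheory GRing.Theory Num.Theory.
Local Open Scope ring_scope.

(* An explicit fractional packing of the monochromatic triangles is built and then rounded.

   Every monochromatic triangle xyz gets the weight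
     wt x y z = sum over u v w of lam x y z u v w,
   where lam depends only on the colours among the six vertices.  A sum-of-squares
   certificate shows that after division by 2 * scale * n^4 the weights of the triangles
   through any edge add up to at most 1: averaged over all orders of z u v w, the quantity
   2 * scale - lam - edge_form is nonnegative for each of the 2-colourings of K_6, and
   edge_form is a sum of positive semidefinite forms.  A second certificate, with the form
   quad_form, shows that the total weight is at least n^2/12 plus a positive multiple of
   the density of "bad" configurations: a monochromatic triangle xyz and a pair uv of the
   opposite colour lying on one side of the bipartition of the vertices given by whether a
   vertex sends a majority of its edges to xyz in the colour of xyz.  If both colour classes
   are far from bipartite then every monochromatic triangle sees many such pairs, and the
   monochromatic triangles have positive density since the total weight is large.

   Rounding costs only o(n^2): the triangles, viewed as triples of edges of K_n, form a
   linear 3-uniform hypergraph, and Roedl's nibble turns a fractional matching with small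
   weights into a matching. *)

(** * Random subsets *)

Section Bernoulli.
Variables (R : realFieldType) (I : finType) (p : I -> R).

Definition bweight (S : {set I}) : R := \prod_i (if i \in S then p i else 1 - p i).
Definition bexp (f : {set I} -> R) : R := \sum_S bweight S * f S.

(** Independence: the mean of a product over the coordinates factorises. The indicators below are
    brought to this product form. *)
Lemma bexp_indep (g h : I -> R) :
  bexp (fun S => \prod_i (if i \in S then g i else h i)) =
  \prod_i (p i * g i + (1 - p i) * h i).
Proof.
rewrite bigA_distr; apply: eq_bigr => S _; rewrite -big_split /=.
by apply: eq_bigr => i _; case: ifP.
Qed.

Lemma bexp_cst (a : R) : bexp (fun=> a) = a.
Proof.
rewrite /bexp -mulr_suml /bweight.
have -> : \sum_(S : {set I}) \prod_i (if i \in S then p i else 1 - p i) = 1.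
  by rewrite -bigA_distr big1 // => i _ /=; ring.
by rewrite mul1r.
Qed.

Lemma bexpD f g : bexp (fun S => f S + g S) = bexp f + bexp g.
Proof. by rewrite /bexp -big_split; apply: eq_bigr => S _; rewrite mulrDr. Qed.

Lemma bexpZ (a : R) f : bexp (fun S => a * f S) = a * bexp f.
Proof. by rewrite /bexp mulr_sumr; apply: eq_bigr => S _; rewrite mulrCA. Qed.

Lemma bexp_sum (J : finType) (P : pred J) (f : J -> {set I} -> R) :
  bexp (fun S => \sum_(j | P j) f j S) = \sum_(j | P j) bexp (f j).
Proof. by rewrite /bexp exchange_big; apply: eq_bigr => S _; rewrite mulr_sumr. Qed.

Lemma eq_bexp (f g : {set I} -> R) : f =1 g -> bexp f = bexp g.
Proof. by move=> fg; apply: eq_bigr => S _; rewrite fg. Qed.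
Arguments eq_bexp {f} g.

Lemma bexp_disjoint (A : {set I}) :
  bexp (fun S => [disjoint S & A]%:R) = \prod_(i in A) (1 - p i).
Proof.
rewrite big_mkcond (eq_bexp (fun S =>
  \prod_i (if i \in S then (i \notin A)%:R else 1))); last first.
  move=> S; case: (boolP [disjoint S & A]) => dSA.
    rewrite big1 // => i _; case: ifP => // iS.
    by rewrite (disjointFr dSA iS).
  have [i iS iA] : exists2 i, i \in S & i \in A.
    by move: dSA; rewrite -setI_eq0 => /set0Pn[i /setIP[]]; exists i.
  by rewrite (bigD1 i) //= iS iA mul0r.
rewrite bexp_indep; apply: eq_bigr => i _.
by case: (i \in A) => /=; ring.
Qed.

Lemma bexp_mem_disjoint (j : I) (A : {set I}) : j \notin A ->
  bexp (fun S => ((j \in S) && [disjoint S & A])%:R) = p j * \prod_(i in A) (1 - p i).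
Proof.
move=> jA; rewrite big_mkcond /=.
rewrite (eq_bexp (fun S =>
  \prod_i (if i \in S then (i \notin A)%:R else (i != j)%:R))); last first.
  move=> S; case: (boolP (j \in S)) => jS /=; last first.
    by rewrite (bigD1 j) //= (negbTE jS) eqxx mul0r.
  case: (boolP [disjoint S & A]) => dSA.
    rewrite big1 // => i _; case: ifP => iS; first by rewrite (disjointFr dSA iS).
    by case: eqP iS => // ->; rewrite jS.
  have [i iS iA] : exists2 i, i \in S & i \in A.
    by move: dSA; rewrite -setI_eq0 => /set0Pn[i /setIP[]]; exists i.
  by rewrite (bigD1 i) //= iS iA mul0r.
rewrite bexp_indep (bigD1 j) //= [RHS](_ : _ = p j * \prod_(i | i != j) (if i \in A then 1 - p i else 1)).
  congr (_ * _); first by rewrite jA eqxx mulr1 mulr0 addr0.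
  apply: eq_bigr => i ij; rewrite ij; case: (i \in A); rewrite /=; ring.
congr (_ * _); rewrite (bigD1 j) //= (negbTE jA) mul1r; apply: eq_bigr => i _.
by [].
Qed.

Hypothesis p01 : forall i, 0 <= p i <= 1.

Lemma bweight_ge0 S : 0 <= bweight S.
Proof.
by apply: prodr_ge0 => i _; have /andP[p0 p1] := p01 i; case: ifP => // _; rewrite subr_ge0.
Qed.

(** The probabilistic method. If every outcome were below the mean, the weighted deficits would be
    nonnegative with sum 0, so all probabilities would vanish, although they sum to 1. *)
Lemma bexp_attained f : exists S, bexp f <= f S.
Proof.
case: (boolP [exists S, bexp f <= f S]) => [/existsP//|].
rewrite negb_exists => /forallP flt.
have f_lt S : f S < bexp f by rewrite ltNge.
have s0 : \sum_S bweight S * (bexp f - f S) = 0.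
  rewrite -[LHS]/(bexp (fun S => bexp f - f S)) (eq_bexp (fun S => bexp f + (-1) * f S)).
    by rewrite bexpD bexp_cst bexpZ mulN1r subrr.
  by move=> S; rewrite mulN1r.
have w0 S : bweight S = 0.
  have /psumr_eq0P : forall S, true -> 0 <= bweight S * (bexp f - f S).
    by move=> ? _; rewrite mulr_ge0 ?bweight_ge0 // subr_ge0 ltW.
  move=> /(_ s0 S isT)/eqP; rewrite mulf_eq0 => /orP[/eqP//|].
  by rewrite subr_eq0 gt_eqF.
have := bexp_cst 1; rewrite /bexp big1 => [/eqP|S _]; last by rewrite w0 mul0r.
by rewrite eq_sym oner_eq0.
Qed.
End Bernoulli.
Arguments eq_bexp {R I p f} g.

(** * The nibble for linear 3-uniform hypergraphs *)

(** Weierstrass's product inequality, used as a union bound; the induction also carries that the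
    product lies between 0 and 1. *)
Lemma prod1B_ge (R : realFieldType) (I : finType) (P : pred I) (x : I -> R) :
  (forall i, P i -> 0 <= x i <= 1) -> 1 - \sum_(i | P i) x i <= \prod_(i | P i) (1 - x i).
Proof.
move=> x01.
suff [] : 1 - \sum_(i | P i) x i <= \prod_(i | P i) (1 - x i) /\
          0 <= \prod_(i | P i) (1 - x i) <= 1 by [].
apply: (big_ind2 (fun s q => 1 - s <= q /\ 0 <= q <= 1)).
- by rewrite subr0 lexx ler01.
- move=> s q s' q' [h1 /andP[h2 h3]] [h4 /andP[h5 h6]]; split; first by nra.
  by rewrite mulr_ge0 //= mulr_ile1.
- move=> i Pi; split=> //; have := x01 _ Pi; lra.
Qed.

Lemma finset_ind (T : finType) (P : {set T} -> Prop) :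
  P set0 -> (forall (U : {set T}) e, e \notin U -> P U -> P (e |: U)) -> forall U, P U.
Proof.
move=> P0 PU U; elim: {U}_.+1 {-2}U (ltnSn #|U|) => // n IH U.
have [->|/set0Pn[e eU]] := eqVneq U set0; first by [].
rewrite -(setD1K eU) cardsU1 !inE eqxx add1n ltnS => Un.
by apply: PU; [rewrite !inE eqxx|apply: IH].
Qed.

(** A fractional matching in a linear 3-uniform hypergraph on [A]; the hypergraph is encoded as the
    support of [w]. *)
Definition frac_matching (R : realFieldType) (V : finType) (eta : R) (A : {set V})
    (w : {set V} -> R) : Prop :=
  [/\ forall T : {set V}, 0 <= w T <= eta,
      forall T : {set V}, w T != 0 -> #|T| = 3%N /\ T \subset A,
      forall T T' : {set V}, w T != 0 -> w T' != 0 -> T != T' -> (#|T :&: T'| <= 1)%N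
    & forall e : V, \sum_(T : {set V} | e \in T) w T <= 1].

Section Nibble.
Variables (R : realFieldType) (V : finType) (A : {set V}) (w : {set V} -> R).
Variables (eta theta : R).
Hypothesis wP : frac_matching eta A w.
Hypotheses (eta1 : eta <= 1) (theta0 : 0 < theta) (theta12 : theta <= 1 / 12%:R).

Let w_ge0 T : 0 <= w T. Proof. by case: wP => /(_ T)/andP[]. Qed.
Let w_le T : w T <= eta. Proof. by case: wP => /(_ T)/andP[]. Qed.
Let w3 (T : {set V}) : w T != 0 -> #|T| = 3%N. Proof. by case: wP => _ h _ _ /h[]. Qed.
Let wA (T : {set V}) : w T != 0 -> T \subset A. Proof. by case: wP => _ h _ _ /h[]. Qed.
Let load1 (e : V) : \sum_(T : {set V} | e \in T) w T <= 1. Proof. by case: wP. Qed.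
Let eta_ge0 : 0 <= eta. Proof. exact: le_trans (w_ge0 set0) (w_le set0). Qed.

(** By linearity at most one triple of the support contains both vertices. *)
Lemma codeg_le (e f : V) : e != f -> \sum_(T : {set V} | (e \in T) && (f \in T)) w T <= eta.
Proof.
move=> ef; case: (pickP (fun T : {set V} => [&& e \in T, f \in T & w T != 0])) => [T /and3P[eT fT wT]|no].
  rewrite (bigD1 T) ?eT //= big1 ?addr0 // => T' /andP[/andP[eT' fT'] TT'].
  apply/eqP/negPn/negP => wT'; case: wP => _ _ /(_ T T' wT wT') + _.
  rewrite eq_sym TT' => /(_ isT); rewrite leqNgt => /negP; apply.
  apply: (@leq_trans #|[set e; f]|); first by rewrite cards2 ef.
  by apply/subset_leq_card/subsetP => x /set2P[] ->; rewrite inE ?eT ?fT ?eT' ?fT'.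
rewrite big1 // => T /andP[eT fT]; apply/eqP.
by have := no T; rewrite eT fT /= => /negbFE.
Qed.

Definition load (e : V) : R := \sum_(T : {set V} | e \in T) w T.

(** The probability that no triple through [e] is selected. *)
Definition nu e : R := \prod_(T : {set V} | e \in T) (1 - theta * w T).

Lemma thetaw T : 0 <= theta * w T <= 1.
Proof.
have w0 := w_ge0 T; have w1 := w_le T; rewrite mulr_ge0 ?(ltW theta0) //=.
have t1 : theta <= 1 by have := theta12; lra.
have w2 : w T <= 1 by exact: le_trans w1 eta1.
by rewrite mulr_ile1 ?(ltW theta0).
Qed.

Lemma nu_ge e : 1 - theta <= nu e.
Proof.
apply: le_trans (prod1B_ge (fun T _ => thetaw T)).
by rewrite -mulr_sumr lerD2l lerN2 ler_piMr // ltW.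
Qed.

Lemma nu_le1 e : nu e <= 1.
Proof. by apply: prodr_ile1 => T _; have := thetaw T => ?; apply/andP; split; lra. Qed.

(* Hyperedges are selected with probability [theta * w T]; each vertex is moreover
   discarded with the probability that makes its total survival probability
   exactly [1 - theta], whatever its degree. *)
Definition prob (i : {set V} + V) : R :=
  match i with inl T => theta * w T | inr e => 1 - (1 - theta) / nu e end.

Lemma prob01 i : 0 <= prob i <= 1.
Proof.
case: i => [T|e] /=; first exact: thetaw.
have := nu_ge e; have := nu_le1 e => n1 n0.
have t12 := theta12; have npos : 0 < nu e by lra.
have : 0 <= (1 - theta) / nu e <= 1.
  by rewrite ler_pdivrMr // mul1r n0 andbT divr_ge0 //; lra.
by lra.
Qed.

(** The coordinates whose selection destroys a vertex of [U]; a vertex survives when none of its own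
    coordinates is selected. *)
Definition star (U : {set V}) : {set {set V} + V} :=
  [set i : {set V} + V | match i with inl T => ~~ [disjoint T & U] | inr e => e \in U end].
Definition surv (S : {set {set V} + V}) : {set V} :=
  [set e | [disjoint S & star [set e]]].

Lemma mem_star1 i e :
  (i \in star [set e]) = match i with inl T => e \in T | inr f => f == e end.
Proof.
by rewrite inE; case: i => [T|f]; rewrite ?inE // disjoint_sym disjoints1 negbK.
Qed.

Lemma survP S (U : {set V}) : (U \subset surv S) = [disjoint S & star U].
Proof.
apply/idP/idP => [/subsetP sU|dS].
  rewrite disjoint_subset; apply/subsetP => i iS; rewrite !inE; apply/negP => iU.
  have [e eU ie] : exists2 e, e \in U & i \in star [set e].
    case: i {iS} iU => [T|f] /= h.
      move: h; rewrite -setI_eq0 => /set0Pn[e /setIP[eT eU]].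
      by exists e; rewrite // mem_star1.
    by exists f; rewrite // mem_star1.
  by have := sU _ eU; rewrite inE => /disjointFr/(_ iS); rewrite ie.
apply/subsetP => e eU; rewrite inE; apply: disjointWr dS.
apply/subsetP => -[T|f]; rewrite mem_star1 inE.
  by move=> eT; rewrite -setI_eq0; apply/set0Pn; exists e; rewrite inE eT.
by move=> /eqP ->.
Qed.

Definition psurv (U : {set V}) : R := bexp prob (fun S => (U \subset surv S)%:R).

Lemma psurvE U : psurv U = \prod_(i in star U) (1 - prob i).
Proof. by rewrite -bexp_disjoint; apply: eq_bexp => S; rewrite survP. Qed.

Lemma psurv0 : psurv set0 = 1.
Proof. by rewrite -[RHS](bexp_cst prob 1); apply: eq_bexp => S; rewrite sub0set. Qed.

Lemma psurv1 e : psurv [set e] = 1 - theta.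
Proof.
rewrite psurvE big_sumType /=.
rewrite (eq_bigl (fun T : {set V} => e \in T)); last by move=> T; rewrite mem_star1.
rewrite [X in _ * X](eq_bigl (pred1 e)); last by move=> f; rewrite mem_star1.
rewrite big_pred1_eq -/(nu e) opprB addrC subrK mulrC divfK //.
by have := nu_ge e; have := theta12 => t12 n1; rewrite gt_eqF //; apply: lt_le_trans n1; lra.
Qed.

Lemma psurv_ge0 U : 0 <= psurv U.
Proof.
by rewrite psurvE; apply: prodr_ge0 => i _; have := prob01 i; lra.
Qed.

(** Survivals are positively correlated and nearly independent: the coordinates common to [star
    [set e]] and [star U] are the triples through [e] meeting [U], of total probability at most
    [#|U| * theta * eta] by [codeg_le]. *)
Lemma psurv_add (e : V) (U : {set V}) : e \notin U ->
  (1 - theta) * psurv U <= psurv (e |: U) /\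
  (1 - #|U|%:R * (theta * eta)) * psurv (e |: U) <= (1 - theta) * psurv U.
Proof.
move=> eU; rewrite -(psurv1 e) !psurvE.
have -> : star (e |: U) = star [set e] :|: star U.
  apply/setP => -[T|f]; rewrite !inE //.
  rewrite -!setI_eq0 setIUr setU_eq0 negb_and //.
set P := fun B : {set _} => \prod_(i in B) (1 - prob i).
have Psplit (B C : {set {set V} + V}) : P B = P (B :&: C) * P (B :\: C).
  by rewrite /P (big_setID C).
have P0 B : 0 <= P B by apply: prodr_ge0 => i _; have := prob01 i; lra.
have P1 B : P B <= 1.
  by apply: prodr_ile1 => i _; have := prob01 i => ?; apply/andP; split; lra.
rewrite -!/(P _) (Psplit (_ :|: _) (star U)) setIUl setIid setDUl setDv setU0.
rewrite (_ : (_ :&: _) :|: _ = star U); last by apply/setUidPr/subsetIr.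
rewrite (Psplit (star [set e]) (star U)).
(* With [x] from the common coordinates, [y] from those of [e] alone and [z] from those of [U], the
   joint probability is [y * z], while the product of the two probabilities is [x * y * z]. *)
set x := P (_ :&: _); set y := P (_ :\: _); set z := P (star U).
have x1 : x <= 1 by exact: P1.
have y0 : 0 <= y by exact: P0.
have z0 : 0 <= z by exact: P0.
suff x_ge : 1 - #|U|%:R * (theta * eta) <= x.
  have yz : 0 <= y * z by exact: mulr_ge0.
  split; first by rewrite -mulrA [z * y]mulrC ler_piMl.
  by rewrite -mulrA [z * y]mulrC ler_wpM2r.
apply: le_trans (prod1B_ge (fun i _ => prob01 i)).
rewrite lerD2l lerN2 big_sumType /=.
rewrite [X in _ + X]big1 ?addr0; last first.
  by move=> f; rewrite inE mem_star1 inE => /andP[/eqP-> eU']; rewrite eU' in eU.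
rewrite -mulr_sumr mulrCA ler_wpM2l ?(ltW theta0) //.
apply: (@le_trans _ _ (\sum_(u in U) \sum_(T : {set V} | (e \in T) && (u \in T)) w T)); last first.
  rewrite -[X in X%:R]sum1_card natr_sum mulr_suml; apply: ler_sum => u uU.
  by rewrite mul1r; apply: codeg_le; apply: contraNneq eU => ->.
rewrite (exchange_big_dep predT) //= big_mkcond; apply: ler_sum => T _.
rewrite in_setI mem_star1 inE; case: ifP => [/andP[eT]|_]; last exact: sumr_ge0.
rewrite -setI_eq0 => /set0Pn[u /setIP[uT uU]].
rewrite (bigD1 u) /= ?uU ?eT ?uT //.
by rewrite lerDl; apply: sumr_ge0.
Qed.

Lemma psurv_ge (U : {set V}) : (1 - theta) ^+ #|U| <= psurv U.
Proof.
elim/finset_ind: U => [|U e eU IH]; first by rewrite cards0 psurv0.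
rewrite cardsU1 eU exprS; have [h _] := psurv_add eU.
by apply: le_trans h; rewrite ler_wpM2l //; have := theta12; lra.
Qed.

(** Each new vertex costs a factor [1 + eta], since [(1 + eta) * (1 - u * theta * eta) >= 1] for
    [u <= 3]. Four vertices are what two triples through a common vertex have besides it. *)
Lemma psurv_le (U : {set V}) : (#|U| <= 4)%N ->
  psurv U <= ((1 + eta) * (1 - theta)) ^+ #|U|.
Proof.
elim/finset_ind: U => [|U e eU IH]; first by rewrite cards0 psurv0.
rewrite cardsU1 eU add1n => U4; have [_ h] := psurv_add eU.
rewrite exprS; have := IH (ltnW U4); have := psurv_ge0 U; have := psurv_ge0 (e |: U).
have : #|U|%:R <= 3%:R :> R by rewrite ler_nat.
move: h; set P := psurv (e |: U); set Q := psurv U.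
move: (ler0n R #|U|); set u := #|U|%:R; set Z := _ ^+ _ => u0 h u3 P0 Q0 QZ.
have [t0 t12 e0 e1] : [/\ 0 < theta, theta <= 1/12%:R, 0 <= eta & eta <= 1].
  by split; [exact: theta0|exact: theta12|exact: eta_ge0|exact: eta1].
have ut : 0 <= u * theta <= 1 / 4%:R.
  by apply/andP; split; nra.
have h1 : 1 <= (1 + eta) * (1 - u * (theta * eta)) by rewrite mulrA; nra.
apply: (@le_trans _ _ ((1 + eta) * ((1 - theta) * Q))).
  apply: (@le_trans _ _ ((1 + eta) * ((1 - u * (theta * eta)) * P))).
    by rewrite mulrA ler_peMl.
  by rewrite ler_wpM2l //; lra.
by rewrite mulrA ler_wpM2l //; nra.
Qed.

Lemma q_gt0 : 0 < 1 - theta.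
Proof. by have := theta12; lra. Qed.

Lemma q_bounds : [/\ 11%:R / 12%:R <= 1 - theta, 1 - theta <= 1,
  ((1 - theta) ^+ 2)^-1 <= 2%:R & ((1 - theta) ^+ 4)^-1 <= 2%:R].
Proof.
have t12 := theta12; have t0 := theta0.
have q1 : 11%:R / 12%:R <= 1 - theta by lra.
have q2 : 2%:R^-1 <= (1 - theta) ^+ 2 by rewrite expr2; nra.
have q4 : 2%:R^-1 <= (1 - theta) ^+ 4.
  have : 5%:R / 6%:R <= (1 - theta) ^+ 2 by rewrite expr2; nra.
  have -> : (1 - theta) ^+ 4 = (1 - theta) ^+ 2 * (1 - theta) ^+ 2 by ring.
  by move: (_ ^+ 2) => z hz; nra.
split=> //; first by lra.
  by rewrite -[leRHS]invrK lef_pV2 // posrE ?invr_gt0 //; apply: lt_le_trans q2; rewrite invr_gt0.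
by rewrite -[leRHS]invrK lef_pV2 // posrE ?invr_gt0 //; apply: lt_le_trans q4; rewrite invr_gt0.
Qed.

(** The surviving load at [e], without asking that [e] survive. The divisor is about the chance that
    the other two vertices of a triple survive, which keeps the mean near [load e]. *)
Definition rload (e : V) (S : {set {set V} + V}) : R :=
  \sum_(T : {set V} | e \in T) w T * (T :\ e \subset surv S)%:R / (1 - theta) ^+ 2.

Lemma bexp_rload e : load e <= bexp prob (rload e).
Proof.
have [q1 q2 _ _] := q_bounds.
rewrite /rload bexp_sum; apply: ler_sum => T eT.
rewrite (eq_bexp (fun S => w T / (1 - theta) ^+ 2 * (T :\ e \subset surv S)%:R)); last first.
  by move=> S; rewrite mulrAC.
rewrite bexpZ -/(psurv _); have [->|wT] := eqVneq (w T) 0; first by rewrite !mul0r.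
have T2 : #|T :\ e| = 2%N.
  by have := w3 wT; rewrite (cardsD1 e) eT => -[].
have := psurv_ge (T :\ e); rewrite T2 => h.
rewrite -mulrA ler_peMr // mulrC ler_pdivlMr ?mul1r //.
by rewrite exprn_gt0 // q_gt0.
Qed.

(** Off the diagonal, two triples through [e] have four distinct further vertices by linearity, so
    [psurv_le] applies; the diagonal costs at most [2 * eta * load e]. *)
Lemma bexp_rload2 e :
  bexp prob (fun S => rload e S ^+ 2) <= (1 + eta) ^+ 4 * load e ^+ 2 + 2%:R * eta.
Proof.
have [q1 q2 _ q4] := q_bounds.
have qp : 0 < (1 - theta) ^+ 4 by rewrite exprn_gt0 // q_gt0.
pose f (T T' : {set V}) := w T * w T' / (1 - theta) ^+ 4.
rewrite (eq_bexp (fun S => \sum_(T : {set V} | e \in T) \sum_(T' : {set V} | e \in T')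
   f T T' * ((T :\ e) :|: (T' :\ e) \subset surv S)%:R)); last first.
  move=> S; rewrite expr2 mulr_suml; apply: eq_bigr => T eT.
  rewrite mulr_sumr; apply: eq_bigr => T' eT'.
  rewrite subUset -mulnb natrM /f.
  have -> : ((1 - theta) ^+ 4)^-1 = ((1 - theta) ^+ 2)^-1 * ((1 - theta) ^+ 2)^-1.
    by rewrite -invfM -exprD.
  by move: (_^-1) => z; ring.
rewrite bexp_sum.
have -> : (1 + eta) ^+ 4 * load e ^+ 2 =
  \sum_(T : {set V} | e \in T) \sum_(T' : {set V} | e \in T') (1 + eta) ^+ 4 * (w T * w T').
  rewrite expr2 mulr_suml mulr_sumr; apply: eq_bigr => T _.
  by rewrite mulr_sumr mulr_sumr.
have : \sum_(T : {set V} | e \in T) 2%:R * (eta * w T) <= 2%:R * eta.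
  by rewrite -!mulr_sumr ler_wpM2l // ler_piMr.
move=> h; apply: le_trans (lerD (lexx _) h).
rewrite -big_split /=; apply: ler_sum => T eT; rewrite bexp_sum.
have [wT0|wT] := eqVneq (w T) 0.
  rewrite big1 ?wT0 ?mulr0 ?addr0; last first.
    by move=> T' _; rewrite bexpZ /f wT0 !mul0r.
  by rewrite big1 // => T' _; rewrite mul0r mulr0.
have TT3 := w3 wT.
rewrite (bigD1 T) //= [X in _ <= X + _](bigD1 T) //=.
rewrite addrAC; apply: lerD.
  rewrite bexpZ -/(psurv _) setUid; apply: (@le_trans _ _ (2%:R * (eta * w T))); last first.
    by rewrite lerDr mulr_ge0 ?exprn_ge0 ?mulr_ge0 // addr_ge0.
  apply: (@le_trans _ _ (f T T)).
    rewrite ler_piMr //; first by rewrite /f divr_ge0 ?(ltW qp) ?mulr_ge0 ?w_ge0.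
    rewrite psurvE; apply: prodr_ile1 => i _; have := prob01 i => ?.
    by apply/andP; split; lra.
  by rewrite /f mulrC ler_pM ?mulr_ge0 ?invr_ge0 ?(ltW qp) // ler_wpM2r.
apply: ler_sum => T' /andP[eT' TT']; rewrite bexpZ -/(psurv _).
have [wT'0|wT'] := eqVneq (w T') 0; first by rewrite /f wT'0 !mulr0 !mul0r.
have T3 := w3 wT'.
have c4 : #|(T :\ e) :|: (T' :\ e)| = 4%N.
  have := cardsUI (T :\ e) (T' :\ e).
  have -> : (T :\ e) :&: (T' :\ e) = set0.
    apply/eqP; rewrite -cards_eq0; case: wP => _ _ /(_ T T' wT wT') + _.
    rewrite eq_sym TT' => /(_ isT); rewrite (cardsD1 e) inE eT eT' /= => h1.
    rewrite -leqn0; apply: leq_trans (_ : #|(T :&: T') :\ e| <= 0)%N; last by [].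
    by apply/subset_leq_card/subsetP => x; rewrite !inE => /andP[/andP[-> ->] /andP[_ ->]].
  rewrite cards0 addn0 => ->; move: TT3 T3.
  by rewrite (cardsD1 e T) (cardsD1 e T') eT eT' !add1n => -[->] [->].
have := psurv_le (U := (T :\ e) :|: (T' :\ e)); rewrite c4 exprMn => /(_ isT) h1.
rewrite /f -mulrA [leRHS]mulrC ler_wpM2l ?mulr_ge0 //.
by rewrite ler_pdivrMl // mulrC.
Qed.

(** Second moment method: [15 * eta] comes from [(1 + eta) ^+ 4 - 1] and [2 * eta] from the diagonal
    terms. *)
Lemma bexp_rload_dev e :
  bexp prob (fun S => (rload e S - load e) ^+ 2) <= 17%:R * eta.
Proof.
have h1 := bexp_rload e; have h2 := bexp_rload2 e.
rewrite (eq_bexp (fun S => rload e S ^+ 2 +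
   ((- 2%:R * load e) * rload e S + load e ^+ 2))); last by move=> S; ring.
rewrite !bexpD bexpZ bexp_cst.
have l0 : 0 <= load e by apply: sumr_ge0.
have l1 : load e <= 1 by exact: load1.
have e0 := eta_ge0; have e1 := eta1.
have h3 : (1 + eta) ^+ 4 - 1 <= 15%:R * eta.
  have -> : (1 + eta) ^+ 4 - 1 = eta * (4%:R + eta * (6%:R + eta * (4%:R + eta))) by ring.
  rewrite mulrC ler_wpM2r //.
  have : eta * (4%:R + eta) <= 5%:R by nra.
  set x := eta * _ => hx; have : eta * (6%:R + x) <= 11%:R.
    have : 0 <= x by rewrite mulr_ge0 //; lra.
    nra.
  lra.
move: h1 h2 h3; set B := bexp _ _; set B2 := bexp _ _; set l := load e in l0 l1 *.
set c := (1 + eta) ^+ 4 => h1 h2 h3.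
have : (c - 1) * l ^+ 2 <= 15%:R * eta.
  have : l ^+ 2 <= 1 by rewrite expr_le1.
  have : 0 <= l ^+ 2 by rewrite exprn_ge0.
  set y := l ^+ 2 => y0 y1; nra.
have : l * l <= l * B by rewrite ler_wpM2l.
by rewrite -expr2; lra.
Qed.
(** Double counting of incidences: a triple has three vertices in [A], and every vertex has load at
    most 1. *)
Lemma weight_le : \sum_(T : {set V}) w T * 3%:R <= #|A|%:R.
Proof.
have -> : \sum_(T : {set V}) w T * 3%:R = \sum_(e in A) load e.
  rewrite /load (exchange_big_dep predT) //=; apply: eq_bigr => T _.
  have [->|wT] := eqVneq (w T) 0; first by rewrite mul0r big1.
  rewrite (eq_bigl (mem T)); last first.
    by move=> e /=; case: (boolP (e \in T)) => [/(subsetP (wA wT)) ->|]; rewrite ?andbF.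
  by rewrite sumr_const (w3 wT) mulr_natr.
rewrite -sum1_card natr_sum; apply: ler_sum => e _; exact: load1.
Qed.

(** * The outcome of one random round *)

Section Outcome.
Variables (gamma : R) (S : {set {set V} + V}).
Hypothesis gamma0 : 0 < gamma.

Definition nbrs (T : {set V}) : {set {set V} + V} :=
  [set i : {set V} + V | match i with
    inl T' => (T' != T) && ~~ [disjoint T' & T] | inr _ => false end].
Definition picked : {set {set V}} :=
  [set T : {set V} | (w T != 0) && ((inl T \in S) && [disjoint S & nbrs T])].
(** At a surviving vertex only the other two vertices of a triple are at risk, hence the square and
    not the cube. *)
Definition w1 (T : {set V}) : R := w T * (T \subset surv S)%:R / (1 - theta) ^+ 2.
Definition overload : {set V} :=
  [set e in A | 1 + gamma < \sum_(T : {set V} | e \in T) w1 T].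
(** The correction that restores loads of at most 1 after the rescaling. *)
Definition w2 (T : {set V}) : R := if [disjoint T & overload] then w1 T / (1 + gamma) else 0.

Lemma q2_gt0 : 0 < (1 - theta) ^+ 2.
Proof. by rewrite exprn_gt0 // q_gt0. Qed.

Lemma w1_ge0 T : 0 <= w1 T.
Proof. by rewrite /w1 divr_ge0 ?(ltW q2_gt0) ?mulr_ge0 ?w_ge0 ?ler0n. Qed.

Lemma w1_le T : w1 T <= 2%:R * w T.
Proof.
have [_ _ h _] := q_bounds.
rewrite /w1 mulrC ler_pM ?invr_ge0 ?(ltW q2_gt0) ?mulr_ge0 ?w_ge0 ?ler0n //.
by rewrite ler_piMr ?w_ge0 // lern1 leq_b1.
Qed.

Lemma w1_n0 T : w1 T != 0 -> w T != 0 /\ T \subset surv S.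
Proof.
rewrite /w1; case: (boolP (T \subset _)) => _; last by rewrite mulr0 mul0r eqxx.
by have [->|] := eqVneq (w T) 0; rewrite ?mul0r ?eqxx.
Qed.

Lemma w2_ge0 T : 0 <= w2 T.
Proof.
rewrite /w2; case: ifP => // _; rewrite divr_ge0 ?w1_ge0 //.
by have := gamma0; lra.
Qed.

Lemma w2_le T : w2 T <= w1 T.
Proof.
rewrite /w2; case: ifP => _; last exact: w1_ge0.
have g0 := gamma0; rewrite ler_pdivrMr; last by lra.
by rewrite ler_peMr ?w1_ge0 //; lra.
Qed.

Lemma w2_n0 T : w2 T != 0 -> w T != 0 /\ T \subset surv S.
Proof.
rewrite /w2; case: ifP => [_ h|]; last by rewrite eqxx.
by apply: w1_n0; apply: contraNneq h => ->; rewrite mul0r.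
Qed.

Lemma w2_frac_matching : frac_matching (2%:R * eta) (A :&: surv S) w2.
Proof.
split.
- move=> T; rewrite w2_ge0 /=; apply: le_trans (w2_le T) _.
  by apply: le_trans (w1_le T) _; rewrite ler_wpM2l.
- by move=> T /w2_n0[wT TS]; rewrite w3 // subsetI wA.
- by move=> T T' /w2_n0[wT _] /w2_n0[wT' _]; case: wP => _ _ /(_ T T' wT wT').
move=> e; case: (boolP (e \in overload)) => eo.
  rewrite big1 // => T eT; rewrite /w2 ifF //.
  by apply/negbTE; rewrite -setI_eq0; apply/set0Pn; exists e; rewrite inE eT.
have g0 := gamma0; apply: (@le_trans _ _ (\sum_(T : {set V} | e \in T) w1 T / (1 + gamma))).
  apply: ler_sum => T _; rewrite /w2; case: ifP => // _.
  by rewrite divr_ge0 ?w1_ge0 //; lra.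
rewrite -mulr_suml ler_pdivrMr ?mul1r; last by lra.
move: eo; rewrite inE; case: (boolP (e \in A)) => /= eA; first by rewrite -leNgt.
move=> _; rewrite big1 ?addr_ge0 ?(ltW g0) // => T eT; apply/eqP; apply: contraNT eA.
by move=> /w1_n0[wT _]; apply: (subsetP (wA wT)).
Qed.

Lemma picked_disjoint T T' : T \in picked -> T' \in picked -> T != T' -> [disjoint T & T'].
Proof.
rewrite !inE => /and3P[_ _ dT] /and3P[_ T'S _] TT'; apply: contraT => dTT'.
by move: (disjointFr dT T'S); rewrite inE eq_sym TT' disjoint_sym dTT'.
Qed.

Lemma picked_surv T : T \in picked -> [disjoint T & A :&: surv S].
Proof.
rewrite !inE => /and3P[wT TS _]; rewrite -setI_eq0; apply: contraT => /set0Pn[e].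
rewrite !inE => /and3P[eT eA /disjointFr/(_ TS)].
by rewrite mem_star1 eT.
Qed.

Lemma w1_rload e : \sum_(T : {set V} | e \in T) w1 T <= rload e S.
Proof.
apply: ler_sum => T eT; rewrite ler_wpM2r ?invr_ge0 ?(ltW q2_gt0) //.
rewrite ler_wpM2l ?w_ge0 // ler_nat; case: (boolP (T \subset _)) => // h.
by rewrite (subset_trans (subD1set _ _) h).
Qed.

(** Chebyshev's inequality: at an overloaded vertex [rload] exceeds [1 + gamma] while [load] is at
    most 1, so its summand is at least 1. *)
Lemma overload_le :
  #|overload|%:R <= \sum_(e in A) (rload e S - load e) ^+ 2 / gamma ^+ 2.
Proof.
have g2 : 0 < gamma ^+ 2 by rewrite exprn_gt0.
rewrite -sum1_card natr_sum big_mkcond [leRHS]big_mkcond; apply: ler_sum => e _.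
rewrite inE; case: (boolP (e \in A)) => //= eA; case: ifP => [big_e|_]; last first.
  by rewrite divr_ge0 ?sqr_ge0 // ltW.
rewrite ler_pdivlMr // mul1r ler_pXn2r ?nnegrE ?(ltW gamma0) //.
  by have := w1_rload e; have := load1 e; rewrite -/(load e); lra.
rewrite subr_ge0; apply: le_trans (load1 e) _.
by have := w1_rload e; have := gamma0; lra.
Qed.

(** Scaling costs at most a fraction [gamma] of a total that is at most [#|A|]. Dropping costs at
    most 2 per overloaded vertex, because [w1] is at most [2 * w]. *)
Lemma w2_sum_ge : \sum_(T : {set V}) w1 T - gamma * #|A|%:R - 2%:R * #|overload|%:R <=
  \sum_(T : {set V}) w2 T.
Proof.
have g0 := gamma0.
have h1 : \sum_(T : {set V}) w1 T <= #|A|%:R.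
  apply: le_trans (le_trans (ler_sum _ (fun T _ => w1_le T)) _) weight_le.
  by apply: ler_sum => T _; have := w_ge0 T; lra.
have h2 : \sum_(T : {set V} | ~~ [disjoint T & overload]) w1 T <= 2%:R * #|overload|%:R.
  apply: (@le_trans _ _ (\sum_(e in overload) \sum_(T : {set V} | e \in T) w1 T)).
    rewrite (exchange_big_dep predT) //= big_mkcond; apply: ler_sum => T _.
    case: ifP => [|_]; last by apply: sumr_ge0 => *; exact: w1_ge0.
    rewrite -setI_eq0 => /set0Pn[e /setIP[eT eo]].
    rewrite (bigD1 e) /= ?eo ?eT // lerDl; apply: sumr_ge0 => *; exact: w1_ge0.
  rewrite -sum1_card natr_sum mulr_sumr; apply: ler_sum => e _.
  apply: (@le_trans _ _ (2%:R * load e)); last by rewrite ler_wpM2l // load1.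
  by rewrite mulr_sumr; apply: ler_sum => T _; exact: w1_le.
have h3 T : w1 T - gamma * w1 T - (~~ [disjoint T & overload])%:R * w1 T <= w2 T.
  rewrite /w2; have := w1_ge0 T; set x := w1 T => x0; case: ifP => _ /=; last by nra.
  rewrite mul0r subr0 ler_pdivlMr; last by lra.
  have : 0 <= gamma ^+ 2 * x by rewrite mulr_ge0 // sqr_ge0.
  by rewrite expr2; nra.
have := ler_sum (index_enum {set V}) (fun T (_ : true) => h3 T).
rewrite !sumrB -mulr_sumr.
have -> : \sum_(T : {set V}) (~~ [disjoint T & overload])%:R * w1 T =
   \sum_(T : {set V} | ~~ [disjoint T & overload]) w1 T.
  rewrite [RHS]big_mkcond; apply: eq_bigr => T _.
  by case: [disjoint T & _]; rewrite /= ?mul0r ?mul1r.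
move=> h4; apply: le_trans h4.
have : gamma * (\sum_(T : {set V}) w1 T) <= gamma * #|A|%:R by rewrite ler_wpM2l // ltW.
by lra.
Qed.
End Outcome.

(** A triple is selected with probability [theta * w T], independently of its neighbours. By the
    union bound over its three vertices, no neighbour is selected with probability at least
    [1 - 3 * theta]. *)
Lemma bexp_picked : theta * (1 - 3%:R * theta) * \sum_(T : {set V}) w T <=
  bexp prob (fun S => #|picked S|%:R).
Proof.
rewrite (eq_bexp (fun S => \sum_(T : {set V} | w T != 0)
   ((inl T \in S) && [disjoint S & nbrs T])%:R)); last first.
  move=> S; rewrite -sum1_card natr_sum big_mkcond [RHS]big_mkcond; apply: eq_bigr => T _.
  by rewrite inE; case: (w T != 0) => //=; case: (_ && _).
rewrite bexp_sum mulr_sumr big_mkcond [leRHS]big_mkcond; apply: ler_sum => T _.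
rewrite eq_sym; case: eqP => [<-|/eqP wT] /=; first by rewrite mulr0.
rewrite bexp_mem_disjoint; last by rewrite inE eqxx.
rewrite /= -mulrA [_ * w T]mulrC mulrA ler_wpM2l ?mulr_ge0 ?(ltW theta0) ?w_ge0 //.
apply: le_trans (prod1B_ge (fun i _ => prob01 i)).
rewrite lerD2l lerN2 big_sumType /= [X in _ + X]big1 ?addr0; last by move=> e; rewrite inE.
rewrite -mulr_sumr [leRHS]mulrC ler_wpM2l ?(ltW theta0) //.
apply: (@le_trans _ _ (\sum_(e in T) load e)); last first.
  rewrite -(w3 (_ : w T != 0)) 1?eq_sym // -sum1_card natr_sum.
  by apply: ler_sum => e _; exact: load1.
rewrite /load (exchange_big_dep predT) //= big_mkcond; apply: ler_sum => T' _.
rewrite inE; case: ifP => [/andP[_]|_]; last by apply: sumr_ge0 => *; exact: w_ge0.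
rewrite -setI_eq0 => /set0Pn[e /setIP[eT' eT]].
by rewrite (bigD1 e) /= ?eT ?eT' // lerDl; apply: sumr_ge0 => *; exact: w_ge0.
Qed.

(** Three vertices survive together with probability at least [(1 - theta) ^+ 3], and the rescaling
    takes back two of the factors. *)
Lemma bexp_w1 : (1 - theta) * \sum_(T : {set V}) w T <=
  bexp prob (fun S => \sum_(T : {set V}) w1 S T).
Proof.
rewrite bexp_sum mulr_sumr; apply: ler_sum => T _.
rewrite (eq_bexp (fun S => w T / (1 - theta) ^+ 2 * (T \subset surv S)%:R)); last first.
  by move=> S; rewrite /w1 mulrAC.
rewrite bexpZ -/(psurv _); have [->|wT] := eqVneq (w T) 0; first by rewrite !(mul0r, mulr0).
have := psurv_ge T; rewrite (w3 wT) => h.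
by rewrite mulrC -mulrA ler_wpM2l ?w_ge0 // mulrC ler_pdivlMr ?exprn_gt0 ?q_gt0.
Qed.

Lemma bexp_surv : bexp prob (fun S => #|A :&: surv S|%:R) = (1 - theta) * #|A|%:R.
Proof.
rewrite (eq_bexp (fun S => \sum_(e in A) ([set e] \subset surv S)%:R)); last first.
  move=> S; rewrite -sum1_card natr_sum big_mkcond [RHS]big_mkcond; apply: eq_bigr => e _.
  by rewrite inE sub1set; case: (e \in A) => //=; case: (e \in _).
rewrite bexp_sum (eq_bigr (fun=> 1 - theta)); last by move=> e _; rewrite -/(psurv _) psurv1.
by rewrite sumr_const mulr_natr.
Qed.

(** The term [a * #|A'|] is the error that later rounds will cause; it shrinks because [A'] has
    [(1 - theta) * #|A|] elements on average. The factor [1 - 3 * theta ^+ 2] is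
    [theta * (1 - 3 * theta)] from the picked triples plus [1 - theta] from the kept weight. *)
Lemma nibble_step (a gamma : R) : 0 <= a -> 0 < gamma ->
  exists (M : {set {set V}}) (A' : {set V}) (w' : {set V} -> R),
  [/\ frac_matching (2%:R * eta) A' w', forall T, w' T != 0 -> w T != 0,
      forall T, T \in M -> w T != 0 /\ [disjoint T & A'],
      forall T T', T \in M -> T' \in M -> T != T' -> [disjoint T & T']
    & (1 - 3%:R * theta ^+ 2) * (\sum_(T : {set V}) w T) -
      (gamma + 34%:R * eta / gamma ^+ 2 + a * (1 - theta)) * #|A|%:R <=
      #|M|%:R + \sum_(T : {set V}) w' T - a * #|A'|%:R].
Proof.
move=> a0 g0; have g2 : 0 < gamma ^+ 2 by rewrite exprn_gt0.
(* All random quantities enter one function, so that a single outcome controls their combination. *)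
pose F S := #|picked S|%:R + (\sum_(T : {set V}) w1 S T + ((- gamma * #|A|%:R) +
  ((- (2%:R / gamma ^+ 2)) * \sum_(e in A) (rload e S - load e) ^+ 2 +
   (- a) * #|A :&: surv S|%:R))).
have [S FS] := bexp_attained prob01 F.
exists (picked S), (A :&: surv S), (w2 gamma S); split.
- exact: w2_frac_matching.
- by move=> T /w2_n0[].
- by move=> T TM; rewrite picked_surv //; move: TM; rewrite inE => /andP[].
- exact: picked_disjoint.
have h1 := w2_sum_ge S g0; have h2 := overload_le S g0.
have h3 : bexp prob F <= #|picked S|%:R + \sum_(T : {set V}) w2 gamma S T -
    a * #|A :&: surv S|%:R.
  apply: le_trans FS _; rewrite /F.
  move: h2; rewrite -mulr_suml mulrC => h2.
  have -> : - (2%:R / gamma ^+ 2) * (\sum_(e in A) (rload e S - load e) ^+ 2) =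
     - (2%:R * ((gamma ^+ 2)^-1 * (\sum_(e in A) (rload e S - load e) ^+ 2))) by ring.
  by lra.
apply: le_trans h3; rewrite /F !bexpD !bexpZ bexp_cst bexp_surv.
rewrite [bexp _ (fun S => \sum_(e in A) _)]bexp_sum.
have h4 := bexp_picked; have h5 := bexp_w1.
have h6 : \sum_(e in A) bexp prob (fun S => (rload e S - load e) ^+ 2) <= 17%:R * eta * #|A|%:R.
  rewrite -sum1_card natr_sum mulr_sumr; apply: ler_sum => e _.
  by rewrite mulr1; exact: bexp_rload_dev.
have h7 : 2%:R / gamma ^+ 2 * (\sum_(e in A) bexp prob (fun S => (rload e S - load e) ^+ 2)) <=
   2%:R / gamma ^+ 2 * (17%:R * eta * #|A|%:R).
  by rewrite ler_wpM2l // divr_ge0 // ltW.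
have h8 : 2%:R / gamma ^+ 2 * (17%:R * eta * #|A|%:R) = 34%:R * eta / gamma ^+ 2 * #|A|%:R.
  by ring.
move: h4 h5 h7; rewrite h8; set W := \sum_(T : {set V}) w T; set X := 34%:R * eta / _.
set B1 := bexp _ _; set B2 := bexp _ _; set B3 := _ / _ * _; set n := #|A|%:R.
move=> h4 h5 h7; rewrite [- (2%:R / _) * _]mulNr -/B3.
have -> : (1 - 3%:R * theta ^+ 2) * W = theta * (1 - 3%:R * theta) * W + (1 - theta) * W by ring.
rewrite !mulrDl; lra.
Qed.
End Nibble.

(** Induction on the number of rounds. With error constant [a = 8 / (m + 24)] and [theta = a / 4], a
    round loses at most [a ^+ 2 / 16] per vertex in weight and gains [a ^+ 2 / 4] from the shrinking
    of [A]. The offset 24 makes [a <= 1 / 3], which gives [theta <= 1 / 12] and lets the empty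
    matching start the induction. *)
Lemma nibble_iter (R : realFieldType) (m : nat) : exists2 eta : R, 0 < eta &
  forall (V : finType) (A : {set V}) (w : {set V} -> R), frac_matching eta A w ->
  exists M : {set {set V}}, [/\ forall T, T \in M -> w T != 0,
    forall T T', T \in M -> T' \in M -> T != T' -> [disjoint T & T']
  & \sum_T w T <= #|M|%:R + 8%:R / (m + 24)%:R * #|A|%:R].
Proof.
elim: m => [|m [eta0 eta0_gt0 IH]].
  exists 1 => // V A w wP; exists set0; split=> [T|T T'|]; rewrite ?inE //.
  rewrite cards0 add0r; have := weight_le wP; rewrite -mulr_suml => h.
  have -> : 8%:R / (0 + 24)%:R = 3%:R^-1 :> R by rewrite add0n; field.
  by lra.
set k : R := (m + 24)%:R; have k24 : 24%:R <= k by rewrite ler_nat leq_addl.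
have -> : (m.+1 + 24)%:R = k + 1 by rewrite addSn -natr1.
(* [s] is exactly the amount by which the next constant exceeds [a - a ^+ 2 / 8]; one half of it
   pays for [gamma], the other for the Chebyshev term. *)
pose a := 8%:R / k; pose s := 8%:R / (k ^+ 2 * (k + 1)).
have k0 : 0 < k by lra.
have a0 : 0 < a by rewrite divr_gt0.
have a3 : a <= 3%:R^-1 by rewrite ler_pdivrMr //; lra.
have s0 : 0 < s by rewrite divr_gt0 ?mulr_gt0 ?exprn_gt0 //; lra.
have sE : 8%:R / (k + 1) = s + a - a ^+ 2 / 8%:R.
  by rewrite /s /a; field; apply/andP; split; rewrite gt_eqF //; lra.
pose g := s / 2%:R; have g0 : 0 < g by rewrite divr_gt0.
(* A round can double the weights, hence [eta0 / 2]; the bound [g ^+ 3 / 34] makes the Chebyshev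
   term at most [g]. *)
pose eta := Num.min (eta0 / 2%:R) (Num.min 1 (g ^+ 3 / 34%:R)).
have [e1 e2 e3] : [/\ eta <= eta0 / 2%:R, eta <= 1 & eta <= g ^+ 3 / 34%:R].
  by rewrite /eta !ge_min !lexx ?orbT.
have e0 : 0 < eta by rewrite !lt_min ltr01 !divr_gt0 ?exprn_gt0.
exists eta => // V A w wP.
have t0 : 0 < a / 4%:R by lra.
have t12 : a / 4%:R <= 1 / 12%:R by lra.
have [M1 [A' [w' [w'P w'w M1P M1d M1s]]]] := nibble_step wP e2 t0 t12 (ltW a0) g0.
have [|M' [M'P M'd M's]] := IH V A' w'.
  case: w'P => h1 h2 h3 h4; split=> // T; have /andP[-> /le_trans->//] := h1 T; lra.
have w'A T : w' T != 0 -> #|T| = 3%N /\ T \subset A' by case: w'P => _ h _ _ /h.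
have cross T T' : T \in M1 -> T' \in M' -> [disjoint T & T'].
  move=> /M1P[_ dTA] /M'P/w'A[_ TA']; exact: disjointWr TA' dTA.
exists (M1 :|: M'); split.
- by move=> T; rewrite inE => /orP[/M1P[]|/M'P/w'w].
- move=> T T'; rewrite !inE => /orP[TM|TM] /orP[TM'|TM'] TT'.
  + exact: M1d.
  + exact: cross.
  + by rewrite disjoint_sym cross.
  + exact: M'd.
have -> : #|M1 :|: M'| = (#|M1| + #|M'|)%N.
  rewrite -cardsUI; suff -> : M1 :&: M' = set0 by rewrite cards0 addn0.
  apply/setP => T; rewrite !inE; apply/negP => /andP[TM1 TM'].
  have := cross _ _ TM1 TM'; rewrite -setI_eq0 setIid -cards_eq0.
  by have [-> _] := w'A _ (M'P _ TM').
have W3 := weight_le wP; rewrite -mulr_suml in W3.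
have g2 : 34%:R * eta / g ^+ 2 <= g.
  by rewrite ler_pdivrMr ?exprn_gt0 // -exprS; lra.
rewrite natrD sE; move: M1s M's W3; rewrite -/k -/a.
set W := \sum_(T : {set V}) w T; set W' := \sum_(T : {set V}) w' T; set n := #|A|%:R.
move=> M1s M's W3; have n0 : 0 <= n by rewrite ler0n.
have h1 : 3%:R * (a / 4%:R) ^+ 2 * W <= a ^+ 2 / 16%:R * n.
  have -> : 3%:R * (a / 4%:R) ^+ 2 * W = a ^+ 2 / 16%:R * (W * 3%:R) by field.
  by rewrite ler_wpM2l // divr_ge0 // sqr_ge0.
have h2 : 34%:R * eta / g ^+ 2 * n <= g * n by rewrite ler_wpM2r.
have h3 : 0 <= a ^+ 2 * n by rewrite mulr_ge0 // sqr_ge0.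
have h4 : g * n + g * n = s * n by rewrite -mulrDl /g; congr (_ * _); lra.
move: M1s; rewrite !mulrDl !mulrBr !mulrBl !mulr1 !mul1r.
have -> : a * (a / 4%:R) * n = a ^+ 2 * n / 4%:R by field.
lra.
Qed.

Theorem nibble (R : archiRealFieldType) (delta : R) : 0 < delta -> exists2 eta : R, 0 < eta &
  forall (V : finType) (A : {set V}) (w : {set V} -> R), frac_matching eta A w ->
  exists M : {set {set V}}, [/\ forall T, T \in M -> w T != 0,
    forall T T', T \in M -> T' \in M -> T != T' -> [disjoint T & T']
  & \sum_T w T <= #|M|%:R + delta * #|A|%:R].
Proof.
move=> d0; pose m := Num.truncn (8%:R / delta).
have [eta e0 H] := nibble_iter R m; exists eta => // V A w /H[M [M1 M2 M3]].
exists M; split=> //; apply: le_trans M3 _; rewrite lerD2l ler_wpM2r //.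
have h : 8%:R / delta < m.+1%:R by apply: truncnS_gt.
rewrite ler_pdivrMr ?ltr0n ?addn_gt0 ?orbT // mulrC -ler_pdivrMr //.
by apply: le_trans (ltW h) _; rewrite ler_nat -addn1 leq_add2l.
Qed.

(** * The certificate *)

(* The 5-vertex 2-colourings up to isomorphism and exchange of the colours, each read as a
   10-bit number in the order 01 02 12 03 13 23 ... of the pairs. *)
Definition canon5 : seq nat :=
  [:: 0; 1; 3; 7; 15; 19; 20; 21; 23; 28; 29; 31; 54; 58; 59; 62;
      126; 220]%N.

Section Certificate.
Local Open Scope Z_scope.

(* The tables come from a numerically solved semidefinite program, rounded to rationals and
   multiplied by the common denominator [scale]. *)
Definition scale : Z := 1610612736.

(** One thousandth of [scale], rounded down: the surplus claimed for a bad configuration. *)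
Definition gain : Z := 1610612.

(* Entry [(k, p)]: the value of [psi_at] is [p] at the arguments encoded by [k], see
   [psi_tab]; at all other arguments it is 0. *)
Definition psi_data : seq (Z * Z) :=
  [:: (12, 1010852838); (16, 1966997700); (17, 10546389972); (19, 3841320600); (21, 12528087444);
      (23, 3047341410); (27, 795002496); (41, 1950966018); (43, 5494258980); (49, 2791335816);
      (50, 14975383212); (51, 7368393816); (52, 3895083540); (53, 1662272424); (54, 14975363196);
      (55, 3214304064); (59, 2480549592); (80, 22066586334); (81, 20524493160); (82, 43465726008);
      (83, 12821580828); (86, 23097610602); (88, 66317576292); (90, 56940632280);
      (91, 26707414140); (94, 53875917792); (122, 61172208624); (126, 29791101816);
      (169, 3403091358); (171, 6437279286); (175, 2736769968); (176, 42687500148);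
      (177, 92724823908); (179, 43290914220); (180, 42481182690); (181, 85692229668);
      (183, 42024399876); (187, 3595468536); (191, 1640470428); (208, 16382866068);
      (209, 5480236548); (210, 20187703476); (214, 9903758292); (216, 31007036484);
      (218, 32890138236); (219, 23445430020); (220, 23115725856); (222, 35824859712);
      (248, 27907341714); (250, 85778649936); (254, 26405002206); (336, 7797646128);
      (337, 13738495428); (344, 13561966278); (345, 17571169548); (348, 7007531202);
      (376, 11422942218); (378, 16733631780)].

(* In the next three tables a list of pairs [(d, v)] stands for the positive semidefinite
   matrix which is the sum of the [d * v * v^T]. *)
Definition tri_data : seq (seq (Z * seq Z)) :=
  [::[:: (6, [:: 48420; 79172; 35188; -16297]);
       (6, [:: 29605; 0; -23480; -10003]);
       (6, [:: 0; 0; 16363; 14]);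
       (1638282, [:: 1; 0; 0; 0]);
       (1610616, [:: 0; 0; 0; 1])];
      [:: (6, [:: -5276; -41850; 44338; 13749]);
       (6, [:: 14760; 1; 0; 0]);
       (6, [:: 0; 112; 0; -35]);
       (1309198134, [:: 1; 0; 0; 0]);
       (1610976, [:: 0; 0; 0; 1])];
      [::];
      [:: (6, [:: 68713; 74325; 7657; -23163]);
       (6, [:: -768; 0; 18970; 275]);
       (1602366, [:: 1; 0; 0; 0]);
       (1624308, [:: 0; 0; 0; 1])]].

Definition edge_data : seq (seq (Z * seq Z)) :=
  [::[::];
      [:: (6, [:: 1192; -23696; -22501; 37390; 55765; 1929; 30460; 20066; -3027]);
       (6, [:: -7032; -5875; -5527; 18370; 0; 12469; 8748; 7735; 4174])];
      [:: (12, [:: -16010; -22767; -41353; 9111; 16532; 15372; 27782; 53621; 51571]);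
       (12, [:: 3057; -12945; -4313; 11628; 32847; 2948; 22863; 0; 12920]);
       (12, [:: 5314; -13627; -1448; 25934; 0; 2334; 9745; 0; 2561]);
       (12, [:: 1; -9; -9; 0; 0; 10425; 24; 0; 16]);
       (12, [:: 14; -136; 6; 0; 0; 0; 377; 0; 234])];
      [:: (12, [:: 28771; -21664; -3320; 32158; 22327; 20574; 13998; 21664; 26094]);
       (12, [:: 11365; -5541; -11229; 0; 14452; 7224; 6956; 5541; 9955]);
       (12, [:: -3190; 44; 8121; 0; 0; -4662; -185; -44; 2785]);
       (12, [:: 94; -74; 0; 0; 0; 99; 20; 74; 34]);
       (2683182, [:: 0; 1; 0; 0; 0; 0; 0; -1; 0])];
      [:: (12, [:: -19140; -19168; -6282; 25315; 18996; 5370; 15601; 19168; 22861]);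
       (12, [:: -2944; -305; 4044; 0; 3430; 8407; -3092; 305; 243]);
       (3083070, [:: 0; 1; 0; 0; 0; 0; 0; -1; 0])];
      [::];
      [::];
      [::];
      [:: (6, [:: -20685; -14501; -22191; 21771; 19439; 20908; 22201; 25887; 42619]);
       (6, [:: 2091; 8101; 3312; -7926; -4114; -4828; -3297; 3597; 0]);
       (6, [:: 2; 0; 3; -8; -496; -5; -3; 5943; 0]);
       (6, [:: 8; 0; 12; -30; 942; -18; -12; 0; 0]);
       (6, [:: -53; 0; -83; 200; 0; 120; 83; 0; 0])];
      [:: (6, [:: 47395; 7913; 22140; -28218; -23394; -22565; -22938; -33071; -39494]);
       (6, [:: 0; -33; -4701; 1767; 3691; 4609; 4869; 11774; 17005]);
       (6, [:: 0; 10998; 205; -15; -306; -216; -212; 25; 0]);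
       (6, [:: 0; 0; -16; 219; -1372; 17; 17; 5201; 0]);
       (6, [:: 0; 0; -2391; 1638; 3486; 2528; 2475; 0; 0]);
       (6, [:: 0; 0; 0; 1414; 0; 0; 0; 0; 0])];
      [:: (12, [:: -17793; -4406; -15952; 23753; 22828; 19808; 15952; 13108; 11220]);
       (12, [:: -1281; 115; -4000; 0; 402; 5103; 4000; 3326; -839]);
       (12, [:: -15; -568; -34; 0; 2468; 0; 34; 29; 1074]);
       (3393648, [:: 0; 0; 1; 0; 0; 0; -1; 0; 0])];
      [:: (12, [:: 38016; 10083; 23355; -16301; -10306; -10118; -24242; -25437; -25608]);
       (12, [:: 0; 1271; 12692; -10385; -6295; -1321; -2149; -702; -2306]);
       (12, [:: 0; 0; 0; 4979; 0; 0; 0; 0; -177]);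
       (12, [:: 0; 0; 0; 0; 0; -1; 0; 0; 3649]);
       (12, [:: 0; -1; 0; 0; 2; 52; 3; 1; 0])];
      [::];
      [::];
      [::];
      [::];
      [:: (6, [:: -2374; -14572; -23165; 34664; 29694; 18396; 23165; 19859; 17801]);
       (6, [:: -1; 0; 0; 0; 55; 1; 0; 0; 0]);
       (1522122, [:: 0; 0; 1; 0; 0; 0; -1; 0; 0])];
      [:: (6, [:: -14372; -18076; -25733; 38242; 30002; 15519; 28335; 24117; 21701]);
       (6, [:: 10592; 5134; -2648; 0; -1540; -5604; -4347; -8074; -8118]);
       (6, [:: 0; -492; 54; 0; 9492; -197; -82; -65; -20]);
       (6, [:: 0; 0; 0; 0; 0; 2275; 0; 0; 0])]].

Definition quad_data : seq (seq (Z * seq Z)) :=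
  [::[:: (6, [:: -3212; -2706; -2706; -24528; -3256; 1023; 1023; 5277; -3256; 1023; 1023; 5277; 26573; 4688; 4688; 3212]);
       (6, [:: -3091; -3154; -2604; 1968; -2583; 984; -24585; 5077; -3133; 26553; 984; 4488; 0; 4511; 5100; 3091]);
       (6, [:: -2979; -3039; -2509; 1896; -3039; 26535; 1896; 4303; -2468; 0; -24639; 4915; 0; 4347; 4915; 2979]);
       (6, [:: -15473; -14305; -14517; 9851; -14305; 0; 9851; 23942; -14305; 0; 9851; 23942; 0; 24169; 23942; 15473]);
       (1656366, [:: 1; 0; 0; 0; 0; 0; 0; 0; 0; 0; 0; 0; 0; 0; 0; -1])];
      [:: (6, [:: 1370; -31104; -31104; -30650; 46220; -21574; -21574; -37347; 46220; -21574; -21574; -37347; 75374; 26916; 26916; -39972]);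
       (6, [:: 8; 13698; -14074; -177; 6774; 54516; -34844; 8272; -7044; 34851; -54509; -8076; 0; 15307; -14988; 245]);
       (6, [:: 398; -48728; 29890; -8866; -4725; 0; 6181; 7322; -8824; -5833; 347; 2473; 0; -34503; 50526; 12287]);
       (6, [:: 60; -358; -2467; -1330; -15601; 0; -41462; -16521; 13569; 41514; 52; 17990; 0; 2403; 0; 1843]);
       (6, [:: -913; 4604; 38547; 20307; 15517; 0; -795; -11218; 15517; 0; -795; -11218; 0; -36700; 0; -28144]);
       (6, [:: 0; 0; 0; 0; -16552; 0; 0; -13899; 16552; 0; 0; 13899; 0; 0; 0; 0]);
       (6, [:: 1; 0; 0; 0; -3; 0; -19; -10; 0; 0; 80; 5; 0; -1; 0; 0]);
       (6, [:: 2; -1; 0; -1; -4; 0; 78; 0; 0; 0; 0; -6; 0; -1; 0; 0])];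
      [:: (6, [:: -4115; -36074; 14497; -18304; 14497; -18304; 113835; 78560; -35086; -109189; -10121; 14159; -10121; 14159; 36074; 38960]);
       (6, [:: -11006; -9224; -34531; -3291; 30380; -27695; 0; 912; -12054; 7256; -60717; -92709; 73446; 109300; 9224; 14349]);
       (6, [:: 6584; 3742; -38701; 82606; -25739; 77733; 0; -2782; 9211; -4648; -51497; -40338; -24706; 0; -3742; 8729]);
       (6, [:: -47143; -41236; -34723; 0; -48066; 5017; 0; 1733; -49689; 30782; 7739; 41527; -19840; 0; 41236; 78281]);
       (6, [:: 22; 22; 4; 0; -57; 14; 0; 1; 23; -14; 43; 191; -83; 0; -22; 0]);
       (6, [:: 8; 7; -18; 0; -15; 80; 0; -1; 10; -6; -13; 0; -28; 0; -7; 0]);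
       (6, [:: -1; -1; -32; 0; 75; 0; 0; 1; -2; 1; -33; 0; 21; 0; 1; 0]);
       (6, [:: -2; -1; 68; 0; 0; 0; 0; 1; -3; 1; 8; 0; -27; 0; 1; 0]);
       (1610784, [:: 0; 1; 0; 0; 0; 0; 0; 0; 0; 0; 0; 0; 0; 0; -1; 0])];
      [:: (6, [:: 36176; 6126; -8645; -46623; 6126; -25809; -46623; -24448; 24448; 22444; 66958; -577; 22444; -60174; -577; -8095]);
       (6, [:: -19909; 12825; -7470; 31250; -7340; 31433; 2836; 13455; -13455; -61161; 0; -15696; -391; -16219; 65666; 4455]);
       (6, [:: -25404; -4402; -9531; 10614; 11401; 40109; 32881; 17168; -17168; -15458; 0; 63762; -63083; -20696; 0; 5685]);
       (6, [:: -1; 2; 2; 1; 86; 1; 0; 0; 0; 0; 0; 0; 0; 0; 0; 0]);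
       (6, [:: -1; 86; 2; 0; 0; 1; 1; 0; 0; 0; 0; 0; 0; 0; 0; 0]);
       (6, [:: 0; 0; 85; 0; 0; 1; 0; 0; 0; 0; 0; 0; 0; 0; 0; 0]);
       (1559226, [:: 0; 0; 0; 0; 0; 0; 0; -1; 1; 0; 0; 0; 0; 0; 0; 0])];
      [:: (6, [:: 0; 10442; -10442; 0; -10442; 0; -16376; -7579; 10442; 16376; 0; 7579; 0; 7579; -7579; 0]);
       (1572480, [:: 0; 0; 0; 0; 0; 0; -1; 0; 0; 1; 0; 0; 0; 0; 0; 0])];
      [:: (6, [:: -4303; 736; 736; 142939; -427; 0; 0; 736; -427; 0; 0; 736; -1655; -427; -427; -4303]);
       (6, [:: 69043; 37; 37; 0; -202; 0; 0; -37; -202; 0; 0; -37; 0; 202; 202; -69043]);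
       (6, [:: 0; -46810; 46810; 0; 160; 0; 52817; 19113; -160; -52817; 0; -19113; 0; -9013; 9013; 0]);
       (6, [:: 0; 19113; -19113; 0; 9013; 52817; 0; 46810; -9013; 0; -52817; -46810; 0; 160; -160; 0]);
       (6, [:: 0; -120; -120; 0; -17331; 0; 0; 120; -17331; 0; 0; 120; 0; 17332; 17331; 0]);
       (6, [:: 0; -1; 0; 0; -78; 0; 0; 0; -78; 0; 0; 1; 0; 0; 157; 0]);
       (6, [:: 0; 0; -1; 0; -56; 0; 0; -1; 86; 0; 0; 0; 1; 0; 0; -5]);
       (6, [:: 0; 0; 0; 0; -9; 0; 0; 0; 0; 0; 0; 0; 0; 0; 0; 82]);
       (6, [:: 0; -1; -1; 0; 64; 0; 0; -1; 0; 0; 0; -2; 3; 0; 0; 0]);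
       (2000526, [:: 0; 0; 0; 0; 0; 1; 0; 0; 0; 0; -1; 0; 0; 0; 0; 0]);
       (1610658, [:: 0; 0; 0; 0; 0; 0; 1; 0; 0; -1; 0; 0; 0; 0; 0; 0])]].

Definition gram (n : nat) (vs : seq (Z * seq Z)) : seq (seq Z) :=
  [seq [seq foldr (fun dv acc => dv.1 * nth 0 dv.2 a * nth 0 dv.2 b + acc) 0 vs
    | b <- iota 0 n] | a <- iota 0 n].

Definition psi_tab : seq (seq (seq (seq Z))) := Eval vm_compute in
  [seq [seq [seq [seq
    foldr (fun kv acc => if kv.1 =? Z.of_nat (((a * 4 + b) * 4 + d) * 8 + k)%N
                         then kv.2 else acc) 0 psi_data
    | k <- iota 0 8] | d <- iota 0 4] | b <- iota 0 4] | a <- iota 0 4].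
Definition tri_tab := Eval vm_compute in [seq gram 4 vs | vs <- tri_data].
Definition edge_tab := Eval vm_compute in [seq gram 9 vs | vs <- edge_data].
Definition quad_tab := Eval vm_compute in [seq gram 16 vs | vs <- quad_data].

Definition psi_at (a b d : nat) (r s t : bool) : Z :=
  nth 0 (nth [::] (nth [::] (nth [::] psi_tab a) b) d) (4 * r + 2 * s + t)%N.
Definition tab_at (m : seq (seq Z)) (a b : nat) : Z := nth 0 (nth [::] m a) b.
(** A nonnegative table plus a positive semidefinite form in the last two of [a b d]: this makes the
    triangle weights nonnegative although single values of [lam] need not be. *)
Definition lam_val (a b d : nat) (r s t : bool) : Z :=
  psi_at a b d r s t + tab_at (nth [::] tri_tab a) b d.

(** An upper bound for all entries of [psi_tab] and [tri_tab]; a value of [lam] adds one of each. *)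
Definition half_max : Z := 500000000000.

Section Local.
Variables (V : Type) (c : V -> V -> bool).

Definition mono (x y z : V) : bool :=
  let b := c x y in ~~ (c x z (+) b) && ~~ (c y z (+) b).

(* Colours are taken relative to [b], the colour of the edge [x y], so that everything
   below is invariant under exchanging the two colours. *)
Definition agree (b : bool) (x y z u : V) : nat :=
  (~~ (c x u (+) b) + ~~ (c y u (+) b) + ~~ (c z u (+) b))%N.

Definition lam (x y z u v w : V) : Z :=
  if mono x y z then
    let b := c x y in
    lam_val (agree b x y z u) (agree b x y z v) (agree b x y z w)
      (c u v (+) b) (c u w (+) b) (c v w (+) b)
  else 0.

(** The type of [v] over the root [x y z u], recorded only up to exchanging [x] with [y] and [z]
    with [u]. *)
Definition edge_flag (b : bool) (x y z u v : V) : nat :=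
  (((c x v (+) b) + (c y v (+) b)) * 3 + ((c z v (+) b) + (c u v (+) b)))%N.

Definition edge_class (b : bool) (x y z u : V) : nat :=
  ((((c x z (+) b) + (c y z (+) b)) * 3 + ((c x u (+) b) + (c y u (+) b))) * 2 + (c z u (+) b))%N.

(** As with flag algebras, the root selects a matrix and the types of [v] and [w] an entry, so the
    sum over [v] and [w] is a quadratic form in the numbers of vertices of each type. *)
Definition edge_form (x y z u v w : V) : Z :=
  let b := c x y in
  tab_at (nth [::] edge_tab (edge_class b x y z u)) (edge_flag b x y z u v) (edge_flag b x y z u w).

Definition quad_flag (b : bool) (x y z u v : V) : nat :=
  ((c x v (+) b) * 8 + (c y v (+) b) * 4 + (c z v (+) b) * 2 + (c u v (+) b))%N.

(* Class 6 collects all patterns on which [quad_form] is zero. *)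
Definition quad_class (b : bool) (x y z u : V) : nat :=
  if c x z (+) b then 6%N else
  match c x u (+) b, c y z (+) b, c y u (+) b, c z u (+) b with
  | false, false, false, false => 0%N
  | false, false, false, true => 1%N
  | false, false, true, true => 2%N
  | false, true, true, true => 3%N
  | true, true, false, false => 4%N
  | true, true, false, true => 5%N
  | _, _, _, _ => 6%N
  end.

Definition quad_form (x y z u v w : V) : Z :=
  let b := c x y in
  let k := quad_class b x y z u in
  if k == 6%N then 0
  else tab_at (nth [::] quad_tab k) (quad_flag b x y z u v) (quad_flag b x y z u w).

Definition bad (x y z u v : V) : bool :=
  mono x y z && let b := c x y in
  ((1 < agree b x y z u)%N == (1 < agree b x y z v)%N) && (c u v (+) b).

(** The slack in the bound on the load of the edge [x y]. Single values may be negative; only the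
    sum over the orders of [z u v w] is checked. *)
Definition edge_gap (x y : V) (l : seq V) : Z :=
  if l is [:: z; u; v; w] then 2 * scale - lam x y z u v w - edge_form x y z u v w else 0.

(** The slack in the lower bound on the total weight. After division by [2 * scale * n^4] and by the
    six orders of a triangle, the constant [scale] accounts for [n^2 / 12]. *)
Definition total_gap (l : seq V) : Z :=
  if l is [:: x; y; z; u; v; w] then
    lam x y z u v w - scale - quad_form x y z u v w - (if bad x y z u v then gain else 0)
  else 0.
End Local.

Definition adj (m : seq (seq bool)) (i j : nat) : bool := nth false (nth [::] m i) j.
(** The offsets are the binomial coefficients of the larger end over 2. A diagonal entry is an
    arbitrary bit, so comparisons with a colouring are made off the diagonal. *)
Definition adjmx (l : bitseq) : seq (seq bool) :=
  [seq [seq nth false l (nth 0 [:: 0; 0; 1; 3; 6; 10] (maxn i j) + minn i j)%N | j <- iota 0 6] | i <- iota 0 6].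

Fixpoint all_bits (n : nat) (P : bitseq -> bool) : bool :=
  if n is n'.+1 then all_bits n' (fun l => P (false :: l)) && all_bits n' (fun l => P (true :: l))
  else P [::].

Definition zsum (T : Type) (f : T -> Z) (l : seq T) : Z := foldr (fun s acc => f s + acc) 0 l.

Fixpoint to_bits (k n : nat) : bitseq :=
  if k is k'.+1 then rcons (to_bits k' n./2) (odd n) else [::].

Definition perms4 := Eval vm_compute in permutations (iota 2 4).
Definition perms5 := Eval vm_compute in permutations (iota 0 5).
Definition perms6 := Eval vm_compute in permutations (iota 0 6).
Definition canon := Eval vm_compute in [seq to_bits 10 n | n <- canon5].

(* The positions 1, 3, 6, 10 are those of the pairs 02, 03, 04, 05: the colours of the edges
   from the vertices 2, ..., 5 to 0 and 1 are sorted. *)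
Definition types_sorted (l : bitseq) : bool :=
  let t i := (2 * nth false l i + nth false l i.+1)%N in [&& t 1 <= t 3, t 3 <= t 6 & t 6 <= t 10]%N.

(** Exchanging the colours makes the pair 01 [false]; the other fourteen pairs are enumerated up to
    sorting. *)
Definition edge_check : bool :=
  all_bits 14 (fun l => types_sorted (false :: l) ==>
    let m := adjmx (false :: l) in 0 <=? zsum (edge_gap (adj m) 0%N 1%N) perms4).

(** A canonical colouring of five vertices is extended by the five pairs at the sixth: 18 times 32
    cases. *)
Definition total_check : bool :=
  all (fun l => all_bits 5 (fun l' =>
    let m := adjmx (l ++ l') in 0 <=? zsum (total_gap (adj m)) perms6)) canon.

Lemma edge_checked : edge_check.
Proof. vm_compute. reflexivity. Qed.

Lemma total_checked : total_check.
Proof. vm_compute. reflexivity. Qed.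

End Certificate.

(** * Averaging over the orders of the vertices *)

Lemma all_bitsP n (P : bitseq -> bool) : all_bits n P -> forall l, size l = n -> P l.
Proof.
elim: n P => [|n IH] P /= h l; first by move/size0nil ->.
by case/andP: h => hf ht; case: l => // -[] l [/IH]; [move/(_ _ ht)|move/(_ _ hf)].
Qed.

Lemma zsumE (T : Type) (f : T -> Z) (l : seq T) : zsum f l = \sum_(s <- l) f s.
Proof. by elim: l => [|s l IH] /=; rewrite ?big_nil // big_cons -IH. Qed.

Lemma uniq_map_inj_in (s : seq nat) (t : nat -> nat) : uniq (map t s) -> {in s &, injective t}.
Proof.
move=> u x y xs ys txy.
have : index x s == index y s.
  rewrite -(nth_uniq 0%N _ _ u) ?size_map ?index_mem //.
  by rewrite !(nth_map 0%N) ?index_mem // !nth_index // txy.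
by move/eqP => e; rewrite -(nth_index 0%N xs) e nth_index.
Qed.

(** Applying [t] entrywise is injective on the orders of [B] and stays among them. *)
Lemma perm_map_permutations (B : seq nat) (t : nat -> nat) : uniq B -> perm_eq (map t B) B ->
  perm_eq (map (map t) (permutations B)) (permutations B).
Proof.
move=> uB tB.
have tsub : {subset map (map t) (permutations B) <= permutations B}.
  move=> s /mapP[s']; rewrite !mem_permutations => s'B ->.
  exact: perm_trans (perm_map t s'B) tB.
have t_inj : {in B &, injective t} by apply: uniq_map_inj_in; rewrite (perm_uniq tB).
have u : uniq (map (map t) (permutations B)).
  rewrite map_inj_in_uniq ?permutations_uniq // => s s'.
  rewrite !mem_permutations => sB s'B.
  have : {subset s <= B} by move=> i; rewrite (perm_mem sB).
  have : {subset s' <= B} by move=> i; rewrite (perm_mem s'B).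
  elim: s s' {sB s'B} => [|i s IH] [|j s'] //= s'B sB [tij ts].
  rewrite (t_inj i j (sB _ (mem_head _ _)) (s'B _ (mem_head _ _)) tij) (IH s') // => k ks.
    by rewrite s'B // inE ks orbT.
  by rewrite sB // inE ks orbT.
apply: uniq_perm => //; first exact: permutations_uniq.
by case: (uniq_min_size u tsub); rewrite ?size_map.
Qed.

(* [a p i] is the [i]-th coordinate of the tuple [p]; averaging over all
   permutations of the coordinates reduces a sum over all tuples to symmetrised terms. *)
Lemma sum_perm_ge0 (V W : finType) (B : seq nat) (a : W -> nat -> V) (mk : (nat -> V) -> W)
    (f : seq V -> Z) :
  (forall p, mk (a p) = p) -> (forall g, {in B, a (mk g) =1 g}) ->
  (forall g h, {in B, g =1 h} -> mk g = mk h) -> uniq B ->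
  (forall p, 0 <= \sum_(s <- permutations B) f (map (a p) s)) ->
  0 <= \sum_p f (map (a p) B).
Proof.
move=> mkK aK mk_ext uB f_ge0.
(* Reindexing the tuples by the permutation [t] behind [s] shows that every order gives the same
   sum. *)
have sum_s s : s \in permutations B -> \sum_p f (map (a p) s) = \sum_p f (map (a p) B).
  rewrite mem_permutations => sB; pose t i := nth 0%N s (index i B).
  have sE : s = map t B.
    apply: (@eq_from_nth _ 0%N) => [|i]; first by rewrite size_map (perm_size sB).
    move=> si; have iB : (i < size B)%N by rewrite -(perm_size sB).
    by rewrite (nth_map 0%N) // /t index_uniq.
  have tB : perm_eq (map t B) B by rewrite -sE.
  rewrite [RHS](reindex_inj (h := fun p => mk (a p \o t))) /=.
    apply: eq_bigr => p _; rewrite sE -map_comp; congr f.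
    by apply/eq_in_map => i iB; rewrite aK.
  move=> p q pq; rewrite -(mkK p) -(mkK q); apply: mk_ext => j jB.
  have /mapP[i iB ->] : j \in map t B by rewrite (perm_mem tB).
  by have := congr1 (fun p => a p i) pq; rewrite !aK.
have h : 0 <= \sum_(s <- permutations B) \sum_p f (map (a p) s).
  by rewrite exchange_big; apply: sumr_ge0.
move: h; rewrite (eq_big_seq (fun=> \sum_p f (map (a p) B))) // big_const_seq iter_addr addr0.
by rewrite count_predT size_permutations // pmulrn_lge0 ?fact_gt0.
Qed.

(** * Positive semidefinite tables *)

Lemma gramE n vs a b : (a < n)%N -> (b < n)%N ->
  tab_at (gram n vs) a b = \sum_(dv <- vs) dv.1 * nth 0 dv.2 a * nth 0 dv.2 b.
Proof.
move=> an bn; rewrite /tab_at /gram (nth_map 0%N) ?size_iota // (nth_map 0%N) ?size_iota //.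
by rewrite !nth_iota // !add0n; elim: vs => [|dv vs IH] /=; rewrite ?big_nil // big_cons -IH.
Qed.

(** Each [d * v * v^T] contributes [d] times the square of a sum. *)
Lemma gram_psd (V : finType) n (vs : seq (Z * seq Z)) (f : V -> nat) :
  all (fun dv : Z * seq Z => 0 <= dv.1) vs -> (forall v, (f v < n)%N) ->
  0 <= \sum_v \sum_w tab_at (gram n vs) (f v) (f w).
Proof.
move=> /allP vs_ge0 fn.
rewrite (eq_bigr (fun v => \sum_w \sum_(dv <- vs) dv.1 * nth 0 dv.2 (f v) * nth 0 dv.2 (f w)));
  last by move=> v _; apply: eq_bigr => w _; rewrite gramE.
rewrite (eq_bigr (fun v => \sum_(dv <- vs) \sum_w dv.1 * nth 0 dv.2 (f v) * nth 0 dv.2 (f w)));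
  last by move=> v _; rewrite exchange_big.
rewrite exchange_big big_seq; apply: sumr_ge0 => dv /vs_ge0 dv_ge0.
rewrite (_ : \sum_v _ = dv.1 * (\sum_v nth 0 dv.2 (f v)) ^+ 2).
  by rewrite mulr_ge0 // sqr_ge0.
rewrite expr2 mulr_suml mulr_sumr; apply: eq_bigr => v _.
by rewrite -mulr_sumr mulrA.
Qed.

Lemma tab_psd (V : finType) n data tab k (f : V -> nat) : tab = [seq gram n vs | vs <- data] ->
  all (all (fun dv : Z * seq Z => 0 <= dv.1)) data -> (forall v, (f v < n)%N) ->
  0 <= \sum_v \sum_w tab_at (nth [::] tab k) (f v) (f w).
Proof.
move=> -> /allP d0 fn; have [kd|kd] := ltnP k (size data).
  by rewrite (nth_map [::]) //; apply: gram_psd => //; apply/d0/mem_nth.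
(* Beyond the table the default is the empty matrix, whose entries read as 0. *)
rewrite nth_default ?size_map // big1 // => v _; rewrite big1 // => w _.
by rewrite /tab_at !nth_nil.
Qed.

Lemma tri_tabE : tri_tab = [seq gram 4 vs | vs <- tri_data]. Proof. by vm_compute. Qed.
Lemma edge_tabE : edge_tab = [seq gram 9 vs | vs <- edge_data]. Proof. by vm_compute. Qed.
Lemma quad_tabE : quad_tab = [seq gram 16 vs | vs <- quad_data]. Proof. by vm_compute. Qed.

Lemma all_nth (T : Type) (P : pred T) x (l : seq T) k : P x -> all P l -> P (nth x l k).
Proof. by elim: l k => [|y l IH] [|k] //= Px /andP[Py Pl] //; apply: IH. Qed.

Lemma psi_at_ge0 a b d r s t : 0 <= psi_at a b d r s t.
Proof.
have h : all (all (all (all (Z.leb 0)))) psi_tab by vm_compute.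
have : Z.leb 0 (psi_at a b d r s t).
  apply: (@all_nth _ (Z.leb 0)) => //; apply: (@all_nth _ (all (Z.leb 0))) => //.
  apply: (@all_nth _ (all (all (Z.leb 0)))) => //.
  exact: (@all_nth _ (all (all (all (Z.leb 0))))).
by move/Z.leb_le; lia.
Qed.

Lemma agree_lt4 (V : Type) (c : V -> V -> bool) b x y z u : (agree c b x y z u < 4)%N.
Proof. by rewrite /agree; do 3!case: (_ (+) _). Qed.

Lemma edge_flag_lt9 (V : Type) (c : V -> V -> bool) b x y z u v :
  (edge_flag c b x y z u v < 9)%N.
Proof. by rewrite /edge_flag; do 4!case: (_ (+) _). Qed.

Lemma quad_flag_lt16 (V : Type) (c : V -> V -> bool) b x y z u v :
  (quad_flag c b x y z u v < 16)%N.
Proof. by rewrite /quad_flag; do 4!case: (_ (+) _). Qed.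

Section Sums.
Variables (V : finType) (c : V -> V -> bool).

Lemma lam_sum_ge0 x y z : 0 <= \sum_u \sum_v \sum_w lam c x y z u v w.
Proof.
rewrite /lam; case: (mono c x y z); last by rewrite big1 // => u _; rewrite big1 // => v _; rewrite big1.
apply: sumr_ge0 => u _; rewrite /lam_val.
rewrite (eq_bigr (fun v => \sum_w psi_at (agree c (c x y) x y z u) (agree c (c x y) x y z v)
     (agree c (c x y) x y z w) (c u v (+) c x y) (c u w (+) c x y) (c v w (+) c x y) +
   \sum_w tab_at (nth [::] tri_tab (agree c (c x y) x y z u)) (agree c (c x y) x y z v)
     (agree c (c x y) x y z w))); last by move=> v _; rewrite -big_split.
rewrite big_split addr_ge0 //; last first.
  by apply: tab_psd tri_tabE _ _; [vm_compute|move=> v; apply: agree_lt4].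
by apply: sumr_ge0 => v _; apply: sumr_ge0 => w _; apply: psi_at_ge0.
Qed.

Lemma edge_form_sum_ge0 x y : 0 <= \sum_z \sum_u \sum_v \sum_w edge_form c x y z u v w.
Proof.
apply: sumr_ge0 => z _; apply: sumr_ge0 => u _.
by apply: tab_psd edge_tabE _ _; [vm_compute|move=> v; apply: edge_flag_lt9].
Qed.

Lemma quad_form_sum_ge0 :
  0 <= \sum_x \sum_y \sum_z \sum_u \sum_v \sum_w quad_form c x y z u v w.
Proof.
apply: sumr_ge0 => x _; apply: sumr_ge0 => y _; apply: sumr_ge0 => z _; apply: sumr_ge0 => u _.
rewrite /quad_form; case: (_ == 6%N); first by rewrite big1 // => v _; rewrite big1.
by apply: tab_psd quad_tabE _ _; [vm_compute|move=> v; apply: quad_flag_lt16].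
Qed.
End Sums.

(** * Reduction to the checked colourings *)

Lemma edge_gap_map (V V' : Type) (c : V -> V -> bool) (g : V' -> V) x y l :
  edge_gap c (g x) (g y) (map g l) = edge_gap (fun i j => c (g i) (g j)) x y l.
Proof. by case: l => [|? [|? [|? [|? [|? ?]]]]]. Qed.

Lemma total_gap_map (V V' : Type) (c : V -> V -> bool) (g : V' -> V) l :
  total_gap c (map g l) = total_gap (fun i j => c (g i) (g j)) l.
Proof. by case: l => [|? [|? [|? [|? [|? [|? [|? ?]]]]]]]. Qed.

Lemma addb_negb2 a b : ~~ a (+) ~~ b = a (+) b.
Proof. by case: a; case: b. Qed.

Lemma edge_gap_negb (V : Type) (c : V -> V -> bool) x y l :
  edge_gap (fun i j => ~~ c i j) x y l = edge_gap c x y l.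
Proof.
case: l => [|z [|u [|v [|w [|? ?]]]]] //.
by rewrite /edge_gap /lam /mono /edge_form /agree /edge_class /edge_flag !addb_negb2.
Qed.

Lemma total_gap_negb (V : Type) (c : V -> V -> bool) l :
  total_gap (fun i j => ~~ c i j) l = total_gap c l.
Proof.
case: l => [|x [|y [|z [|u [|v [|w [|? ?]]]]]]] //.
rewrite /total_gap /lam /bad /mono /quad_form /agree /quad_class /quad_flag.
by rewrite !addb_negb2.
Qed.

(** Over distinct vertices a gap reads no diagonal colour, which allows passing from a colouring to
    [adjmx]. *)
Lemma edge_gap_ext (V : eqType) (c c' : V -> V -> bool) x y l : uniq [:: x, y & l] ->
  {in [:: x, y & l] &, forall i j, i != j -> c i j = c' i j} ->
  edge_gap c x y l = edge_gap c' x y l.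
Proof.
case: l => [|z [|u [|v [|w [|? ?]]]]] // U E.
have {}E (i j : nat) : (i < j < 6)%N ->
    c (nth x [:: x; y; z; u; v; w] i) (nth x [:: x; y; z; u; v; w] j) =
    c' (nth x [:: x; y; z; u; v; w] i) (nth x [:: x; y; z; u; v; w] j).
  move=> /andP[ij j6]; have i6 := ltn_trans ij j6.
  by apply: E; rewrite ?mem_nth // nth_uniq // neq_ltn ij.
rewrite /edge_gap /lam /mono /edge_form /agree /edge_class /edge_flag.
rewrite (E 0%N 1%N) // (E 0%N 2%N) // (E 0%N 3%N) // (E 0%N 4%N) // (E 0%N 5%N) //.
rewrite (E 1%N 2%N) // (E 1%N 3%N) // (E 1%N 4%N) // (E 1%N 5%N) //.
rewrite (E 2%N 3%N) // (E 2%N 4%N) // (E 2%N 5%N) //.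
by rewrite (E 3%N 4%N) // (E 3%N 5%N) // (E 4%N 5%N).
Qed.

Lemma total_gap_ext (V : eqType) (c c' : V -> V -> bool) l : uniq l ->
  {in l &, forall i j, i != j -> c i j = c' i j} -> total_gap c l = total_gap c' l.
Proof.
case: l => [|x [|y [|z [|u [|v [|w [|? ?]]]]]]] // U E.
have {}E (i j : nat) : (i < j < 6)%N ->
    c (nth x [:: x; y; z; u; v; w] i) (nth x [:: x; y; z; u; v; w] j) =
    c' (nth x [:: x; y; z; u; v; w] i) (nth x [:: x; y; z; u; v; w] j).
  move=> /andP[ij j6]; have i6 := ltn_trans ij j6.
  by apply: E; rewrite ?mem_nth // nth_uniq // neq_ltn ij.
rewrite /total_gap /lam /bad /mono /quad_form /agree /quad_class /quad_flag.
rewrite (E 0%N 1%N) // (E 0%N 2%N) // (E 0%N 3%N) // (E 0%N 4%N) // (E 0%N 5%N) //.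
rewrite (E 1%N 2%N) // (E 1%N 3%N) // (E 1%N 4%N) // (E 1%N 5%N) //.
rewrite (E 2%N 3%N) // (E 2%N 4%N) // (E 2%N 5%N) //.
by rewrite (E 3%N 4%N) // (E 3%N 5%N) // (E 4%N 5%N).
Qed.

Definition pat (k : nat) (c : nat -> nat -> bool) : bitseq :=
  [seq c i j | j <- iota 0 k, i <- iota 0 j].

Definition relabel (s : seq nat) (c : nat -> nat -> bool) (i j : nat) : bool :=
  c (nth 0%N s i) (nth 0%N s j).

Lemma adj_adjmx (c : nat -> nat -> bool) : (forall i j, c i j = c j i) ->
  {in iota 0 6 &, forall i j, i != j -> c i j = adj (adjmx (pat 6 c)) i j}.
Proof.
move=> csym i j; rewrite !mem_iota /=.
move: i j => [|[|[|[|[|[|i]]]]]] [|[|[|[|[|[|j]]]]]] //= _ _ _; exact: csym.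
Qed.

Lemma perm_uniq_iota s m k : perm_eq s (iota m k) -> uniq s.
Proof. by move/perm_uniq ->; apply: iota_uniq. Qed.

Lemma perms4E : perms4 = permutations (iota 2 4). Proof. by vm_compute. Qed.
Lemma perms5E : perms5 = permutations (iota 0 5). Proof. by vm_compute. Qed.
Lemma perms6E : perms6 = permutations (iota 0 6). Proof. by vm_compute. Qed.

Lemma sum_total_gap_relabel s c : s \in permutations (iota 0 6) ->
  \sum_(t <- permutations (iota 0 6)) total_gap (relabel s c) t =
  \sum_(t <- permutations (iota 0 6)) total_gap c t.
Proof.
rewrite mem_permutations => s6.
have tB : perm_eq (map (nth 0%N s) (iota 0 6)) (iota 0 6).
  have -> // : map (nth 0%N s) (iota 0 6) = s.
  by rewrite -[6%N]/(size (iota 0 6)) -(perm_size s6); apply: mkseq_nth.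
rewrite -[RHS](perm_big _ (perm_map_permutations (iota_uniq 0 6) tB)) big_map.
by apply: eq_bigr => t _; rewrite total_gap_map.
Qed.

Lemma sum_edge_gap_relabel s c : s \in permutations (iota 2 4) ->
  \sum_(t <- permutations (iota 2 4)) edge_gap (relabel [:: 0, 1 & s]%N c) 0%N 1%N t =
  \sum_(t <- permutations (iota 2 4)) edge_gap c 0%N 1%N t.
Proof.
rewrite mem_permutations => s6.
have tB : perm_eq (map (nth 0%N [:: 0, 1 & s]%N) (iota 2 4)) (iota 2 4).
  have -> // : map (nth 0%N [:: 0, 1 & s]%N) (iota 2 4) = s.
  rewrite (iotaDl 2 0 4) -map_comp -[4%N]/(size (iota 2 4)) -(perm_size s6).
  exact: mkseq_nth.
rewrite -[RHS](perm_big _ (perm_map_permutations (iota_uniq 2 4) tB)) big_map.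
by apply: eq_bigr => t _; rewrite -(edge_gap_map c (nth 0%N [:: 0, 1 & s]%N) 0%N 1%N).
Qed.

Fixpoint eq_bits (l l' : bitseq) : bool :=
  match l, l' with
  | [::], [::] => true
  | a :: l, b :: l' => if a (+) b then false else eq_bits l l'
  | _, _ => false
  end.

Lemma eq_bitsP l l' : eq_bits l l' -> l = l'.
Proof. by elim: l l' => [|a l IH] [|b l'] //=; case: a; case: b => //= /IH ->. Qed.

Definition canon_cover : bool :=
  all_bits 10 (fun l => let m := adjmx l in has (fun s =>
    let l' := pat 5 (relabel s (adj m)) in
    has (eq_bits l') canon || has (eq_bits (map negb l')) canon) perms5).

(** The eight bits are the colours from the vertices 2, ..., 5 to 0 and 1; some order of these
    vertices meets [types_sorted]. *)
Definition sort_cover : bool :=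
  all_bits 8 (fun l => has (fun s =>
    let t i := let j := (nth 0 s i - 2)%N in (2 * nth false l (2 * j) + nth false l (2 * j).+1)%N in
    [&& t 0%N <= t 1%N, t 1%N <= t 2%N & t 2%N <= t 3%N]%N) perms4).

Lemma canon_covered : canon_cover. Proof. by vm_compute. Qed.
Lemma sort_covered : sort_cover. Proof. by vm_compute. Qed.

Lemma total_gap_pos_canon c : (forall i j, c i j = c j i) -> pat 5 c \in canon ->
  0 <= \sum_(t <- permutations (iota 0 6)) total_gap c t.
Proof.
move=> csym /(allP total_checked) /all_bitsP/(_ [seq c i 5 | i <- iota 0 5] erefl) h.
have {h} : Z.leb 0 (zsum (total_gap (adj (adjmx (pat 6 c)))) perms6) by exact: h.
rewrite zsumE perms6E => /Z.leb_le h; rewrite (eq_big_seq (total_gap (adj (adjmx (pat 6 c))))).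
  by move: h; set x := \sum_(s <- _) _; lia.
move=> t; rewrite mem_permutations => t6; apply: total_gap_ext; first exact: perm_uniq_iota t6.
by move=> i j; rewrite !(perm_mem t6); apply: adj_adjmx.
Qed.

(** The sum over all orders is invariant under relabelling and under exchange of the colours. By
    [canon_covered] the first five vertices can be made canonical, with the sixth left in place. *)
Lemma total_gap_pos c : (forall i j, c i j = c j i) ->
  0 <= \sum_(t <- permutations (iota 0 6)) total_gap c t.
Proof.
move=> csym; have /hasP[s s5 hs] := all_bitsP canon_covered (l := pat 5 c) erefl.
have s5' : perm_eq s (iota 0 5) by rewrite -mem_permutations -perms5E.
have s6 : rcons s 5 \in permutations (iota 0 6).
  by rewrite mem_permutations -[iota 0 6]/(rcons (iota 0 5) 5) -!cats1 perm_cat2r.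
rewrite -(sum_total_gap_relabel _ s6); set c1 := relabel _ c.
have c1sym i j : c1 i j = c1 j i by apply: csym.
have s_size : size s = 5 by rewrite (perm_size s5').
have bE i j : i != j -> (i < 5)%N -> (j < 5)%N -> adj (adjmx (pat 5 c)) i j = c i j.
  by move: i j => [|[|[|[|[|i]]]]] [|[|[|[|[|j]]]]] //= _ _ _; rewrite csym.
have lt5 i : (i < 5)%N -> (nth 0%N s i < 5)%N.
  move=> i5; have : nth 0%N s i \in s by rewrite mem_nth ?s_size.
  by rewrite (perm_mem s5') mem_iota.
have patE : pat 5 (relabel s (adj (adjmx (pat 5 c)))) = pat 5 c1.
  have E i j : (i < j < 5)%N -> relabel s (adj (adjmx (pat 5 c))) i j = c1 i j.
    move=> /andP[ij j5]; have i5 := ltn_trans ij j5.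
    rewrite /c1 /relabel !nth_rcons s_size i5 j5 bE //.
    - by rewrite nth_uniq ?s_size // ?(perm_uniq_iota s5') // neq_ltn ij.
    - exact: lt5.
    - exact: lt5.
  by rewrite /pat /= !E.
have hasP l : has (eq_bits l) canon -> l \in canon by case/hasP => l' l'c /eq_bitsP ->.
have {hs} : let l := pat 5 (relabel s (adj (adjmx (pat 5 c)))) in
    has (eq_bits l) canon || has (eq_bits (map negb l)) canon by exact: hs.
rewrite patE => /orP[/hasP|/hasP neg]; first exact: total_gap_pos_canon.
rewrite -(eq_bigr _ (fun t _ => total_gap_negb c1 t)).
by apply: total_gap_pos_canon => // i j; rewrite c1sym.
Qed.

Lemma edge_gap_pos_sorted c : (forall i j, c i j = c j i) -> c 0%N 1%N = false ->
  types_sorted (pat 6 c) -> 0 <= \sum_(t <- permutations (iota 2 4)) edge_gap c 0%N 1%N t.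
Proof.
move=> csym c01 srt; have h := all_bitsP edge_checked (l := behead (pat 6 c)) erefl.
have patE : false :: behead (pat 6 c) = pat 6 c by rewrite -[in LHS]c01.
have {h} : types_sorted (pat 6 c) ==>
    Z.leb 0 (zsum (edge_gap (adj (adjmx (pat 6 c))) 0%N 1%N) perms4).
  by rewrite -patE; exact: h.
rewrite srt implyTb.
rewrite zsumE perms4E => /Z.leb_le h.
rewrite (eq_big_seq (edge_gap (adj (adjmx (pat 6 c))) 0%N 1%N)).
  by move: h; set x := \sum_(s <- _) _; lia.
move=> t; rewrite mem_permutations => t4.
have t6 : perm_eq [:: 0, 1 & t]%N (iota 0 6) by rewrite -[iota 0 6]/([:: 0, 1 & iota 2 4]%N) !perm_cons.
apply: edge_gap_ext; first exact: perm_uniq_iota t6.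
by move=> i j; rewrite !(perm_mem t6); apply: adj_adjmx.
Qed.

(** The colours are exchanged if 01 is [true], and the other vertices are sorted by their colours to
    0 and 1. *)
Lemma edge_gap_pos c : (forall i j, c i j = c j i) ->
  0 <= \sum_(t <- permutations (iota 2 4)) edge_gap c 0%N 1%N t.
Proof.
wlog c01 : c / c 0%N 1%N = false => [hw csym|csym].
  case c01: (c 0%N 1%N); last exact: hw.
  rewrite -(eq_bigr _ (fun t _ => edge_gap_negb c 0%N 1%N t)).
  by apply: hw => [|i j]; rewrite ?c01 // csym.
pose l := [seq c i j | j <- iota 2 4, i <- [:: 0; 1]%N].
have /hasP[s s4 hs] := all_bitsP sort_covered (l := l) erefl.
rewrite perms4E in s4; rewrite -(sum_edge_gap_relabel _ s4).
apply: edge_gap_pos_sorted => [i j||]; rewrite ?c01 //; first exact: csym.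
move: s4; rewrite mem_permutations => s4.
have lE i (b : bool) : (1 < i < 6)%N -> nth false l (2 * (i - 2) + b)%N = c b i.
  move=> i25; have : i \in iota 2 4 by rewrite mem_iota.
  by rewrite !inE => /or4P[]/eqP->; case: b; reflexivity.
have sE i : (i < 4)%N -> (1 < nth 0%N s i < 6)%N.
  move=> i4; have : nth 0%N s i \in s by rewrite mem_nth // (perm_size s4).
  by rewrite (perm_mem s4) mem_iota.
have lE0 i : (i < 4)%N -> nth false l (2 * (nth 0%N s i - 2)) = c 0%N (nth 0%N s i).
  by move=> /sE /(lE _ false); rewrite addn0.
have lE1 i : (i < 4)%N -> nth false l (2 * (nth 0%N s i - 2)).+1 = c 1%N (nth 0%N s i).
  by move=> /sE /(lE _ true); rewrite addn1.
by move: hs; cbv zeta beta; rewrite !lE0 // !lE1.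
Qed.

(** * Summing over the vertices *)

Lemma edge_gapE (V : Type) (c : V -> V -> bool) x y z u v w :
  edge_gap c x y [:: z; u; v; w] = 2 * scale - lam c x y z u v w - edge_form c x y z u v w.
Proof. reflexivity. Qed.

Lemma total_gapE (V : Type) (c : V -> V -> bool) x y z u v w :
  total_gap c [:: x; y; z; u; v; w] =
  lam c x y z u v w - scale - quad_form c x y z u v w - (if bad c x y z u v then gain else 0).
Proof. reflexivity. Qed.

Section GraphSums.
Variables (V : finType) (c : V -> V -> bool).
Hypothesis csym : forall x y, c x y = c y x.

Lemma edge_gap_sum_ge0 x y : 0 <= \sum_z \sum_u \sum_v \sum_w edge_gap c x y [:: z; u; v; w].
Proof.
rewrite !pair_bigA.
pose a (p : V * V * V * V) (i : nat) :=
  match i with 2 => p.1.1.1 | 3 => p.1.1.2 | 4 => p.1.2 | _ => p.2 end%N.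
pose mk (g : nat -> V) := (g 2, g 3, g 4, g 5)%N.
rewrite (eq_bigr (fun p => edge_gap c x y (map (a p) (iota 2 4)))); last first.
  by move=> [[[z u] v] w] _; congr (edge_gap c x y _).
apply: (@sum_perm_ge0 V _ (iota 2 4) a mk (edge_gap c x y)); last first.
(* Tuples with repeated vertices are covered too: the colouring is pulled back along [g] to the
   positions, and the pullback is again symmetric. *)
- move=> p; pose g (i : nat) := match i with 0 => x | 1 => y | _ => a p i end%N.
  rewrite (eq_big_seq (edge_gap (fun i j => c (g i) (g j)) 0%N 1%N)).
    by apply: edge_gap_pos => i j; apply: csym.
  move=> s; rewrite mem_permutations => s4.
  rewrite -[RHS](edge_gap_map c g 0%N 1%N); congr edge_gap.
  apply/eq_in_map => i; rewrite (perm_mem s4) mem_iota.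
  by case: i => [|[|i]].
- exact: iota_uniq.
- by move=> g h gh; rewrite /mk !gh.
- by move=> g i; rewrite !inE => /or4P[]/eqP->.
- by move=> [[[z u] v] w].
Qed.

Lemma total_gap_sum_ge0 :
  0 <= \sum_x \sum_y \sum_z \sum_u \sum_v \sum_w total_gap c [:: x; y; z; u; v; w].
Proof.
rewrite !pair_bigA.
pose a (p : V * V * V * V * V * V) (i : nat) :=
  match i with 0 => p.1.1.1.1.1 | 1 => p.1.1.1.1.2 | 2 => p.1.1.1.2
  | 3 => p.1.1.2 | 4 => p.1.2 | _ => p.2 end%N.
pose mk (g : nat -> V) := (g 0, g 1, g 2, g 3, g 4, g 5)%N.
rewrite (eq_bigr (fun p => total_gap c (map (a p) (iota 0 6)))); last first.
  by move=> [[[[[x y] z] u] v] w] _; congr (total_gap c _).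
apply: (@sum_perm_ge0 V _ (iota 0 6) a mk (total_gap c)); last first.
- move=> p; rewrite (eq_big_seq (total_gap (fun i j => c (a p i) (a p j)))).
    by apply: total_gap_pos => i j; apply: csym.
  by move=> s _; rewrite total_gap_map.
- exact: iota_uniq.
- by move=> g h gh; rewrite /mk !gh.
- by move=> g i; rewrite mem_iota; move: i => [|[|[|[|[|[|i]]]]]].
- by move=> [[[[[x y] z] u] v] w].
Qed.

(** The two sides differ by the sums of [edge_gap] and [edge_form], both nonnegative. *)
Lemma lam_load_le x y :
  \sum_z \sum_u \sum_v \sum_w lam c x y z u v w <= (2 * scale) *+ (#|V| ^ 4).
Proof.
have h1 := edge_form_sum_ge0 c x y; have h2 := edge_gap_sum_ge0 x y.
have : \sum_z \sum_u \sum_v \sum_w edge_gap c x y [:: z; u; v; w] +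
  \sum_z \sum_u \sum_v \sum_w edge_form c x y z u v w +
  \sum_z \sum_u \sum_v \sum_w lam c x y z u v w = (2 * scale) *+ (#|V| ^ 4).
  rewrite !expnS muln1 !mulrnA -4!sumr_const -!big_split; apply: eq_bigr => z _.
  rewrite -!big_split; apply: eq_bigr => u _; rewrite -!big_split; apply: eq_bigr => v _.
  rewrite -!big_split; apply: eq_bigr => w _; rewrite edge_gapE.
  by move: scale (lam _ _ _ _ _ _ _) (edge_form _ _ _ _ _ _ _) => k p q /=; lia.
by lia.
Qed.

Lemma lam_total_ge :
  scale *+ (#|V| ^ 6) + \sum_x \sum_y \sum_z \sum_u \sum_v \sum_(w : V) gain *+ bad c x y z u v <=
  \sum_x \sum_y \sum_z \sum_u \sum_v \sum_w lam c x y z u v w.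
Proof.
have h1 := quad_form_sum_ge0 c; have h2 := total_gap_sum_ge0.
have : \sum_x \sum_y \sum_z \sum_u \sum_v \sum_w total_gap c [:: x; y; z; u; v; w] +
  \sum_x \sum_y \sum_z \sum_u \sum_v \sum_w quad_form c x y z u v w +
  (scale *+ (#|V| ^ 6) + \sum_x \sum_y \sum_z \sum_u \sum_v \sum_(w : V) gain *+ bad c x y z u v) =
  \sum_x \sum_y \sum_z \sum_u \sum_v \sum_w lam c x y z u v w.
  rewrite !expnS muln1 !mulrnA -6!sumr_const -!big_split; apply: eq_bigr => x _.
  rewrite -!big_split; apply: eq_bigr => y _; rewrite -!big_split; apply: eq_bigr => z _.
  rewrite -!big_split; apply: eq_bigr => u _; rewrite -!big_split; apply: eq_bigr => v _.
  rewrite -!big_split; apply: eq_bigr => w _; rewrite total_gapE.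
  move: scale gain (lam _ _ _ _ _ _ _) (quad_form _ _ _ _ _ _ _) => k g p q.
  by case: (bad _ _ _ _ _ _); rewrite /= ?mulr1n ?mulr0n; lia.
by lia.
Qed.
End GraphSums.

Definition lam_max : Z := half_max *+ 2.

Lemma lam_le (V : Type) (c : V -> V -> bool) x y z u v w : lam c x y z u v w <= lam_max.
Proof.
have hp : all (all (all (all (fun a => Z.leb a half_max)))) psi_tab by vm_compute.
have ht : all (all (all (fun a => Z.leb a half_max))) tri_tab by vm_compute.
rewrite /lam; case: (mono c x y z); last by vm_compute.
rewrite /lam_val; set p := psi_at _ _ _ _ _ _; set t := tab_at _ _ _.
have /Z.leb_le p_le : Z.leb p half_max.
  apply: (@all_nth _ (fun a => Z.leb a half_max)) => //.
  apply: (@all_nth _ (all (fun a => Z.leb a half_max))) => //.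
  apply: (@all_nth _ (all (all (fun a => Z.leb a half_max)))) => //.
  exact: (@all_nth _ (all (all (all (fun a => Z.leb a half_max))))).
have /Z.leb_le t_le : Z.leb t half_max.
  apply: (@all_nth _ (fun a => Z.leb a half_max)) => //.
  apply: (@all_nth _ (all (fun a => Z.leb a half_max))) => //.
  exact: (@all_nth _ (all (all (fun a => Z.leb a half_max)))).
by rewrite /lam_max mulr2n; move: half_max p t p_le t_le => h p t; lia.
Qed.

Section Symmetry.
Variables (V : Type) (c : V -> V -> bool).
Hypothesis csym : forall x y, c x y = c y x.

Lemma lamC12 x y z u v w : lam c y x z u v w = lam c x y z u v w.
Proof.
rewrite /lam /mono (csym y x) andbC; case: ifP => // _.
have agreeC b t : agree c b y x z t = agree c b x y z t by rewrite /agree (addnC (~~ _)).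
by rewrite !agreeC.
Qed.

(** The reference colour changes from that of [x y] to that of [x z]; these agree when the triangle
    is monochromatic, and otherwise [lam] is 0. *)
Lemma lamC23 x y z u v w : lam c x z y u v w = lam c x y z u v w.
Proof.
have mE : mono c x z y = mono c x y z.
  by rewrite /mono (csym z y); case: (c x y); case: (c x z); case: (c y z).
rewrite /lam mE; case: (boolP (mono c x y z)) => // m.
have <- : c x y = c x z.
  by move: m; rewrite /mono; case: (c x y); case: (c x z).
have agreeC b t : agree c b x z y t = agree c b x y z t by rewrite /agree addnAC.
by rewrite !agreeC.
Qed.
End Symmetry.

(** * Triangle weights in an ordered field *)

Fact ofZ_key : unit. Proof. exact: tt. Qed.

Section Weights.
Variables (R : realFieldType) (V : finType) (c : V -> V -> bool).
Hypothesis csym : forall x y, c x y = c y x.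
Let n := #|V|.

(* Locked: unfolding [ofZ scale] would compute with unary numerals. *)
Definition ofZ (z : Z) : R := locked_with ofZ_key (fun z => (int_of_Z z)%:~R) z.

Lemma ofZE z : ofZ z = (int_of_Z z)%:~R.
Proof. by rewrite /ofZ locked_withE. Qed.

Lemma ofZ_sum (I : finType) (f : I -> Z) : ofZ (\sum_i f i) = \sum_i ofZ (f i).
Proof. by rewrite ofZE !raddf_sum; apply: eq_bigr => i _; rewrite ofZE. Qed.

Lemma ofZ_le x y : x <= y -> ofZ x <= ofZ y.
Proof. by move=> xy; rewrite !ofZE ler_int; lia. Qed.

Lemma ofZ_mulrn x k : ofZ (x *+ k) = ofZ x *+ k.
Proof. by rewrite !ofZE !raddfMn. Qed.

Lemma ofZD x y : ofZ (x + y) = ofZ x + ofZ y.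
Proof. by rewrite !ofZE !raddfD. Qed.

Lemma ofZ0 : ofZ 0 = 0.
Proof. by rewrite ofZE raddf0. Qed.

Definition wt (x y z : V) : R := ofZ (\sum_u \sum_v \sum_w lam c x y z u v w).

Lemma wt_ge0 x y z : 0 <= wt x y z.
Proof. by rewrite -ofZ0; apply/ofZ_le/lam_sum_ge0. Qed.

Lemma wt_mono x y z : wt x y z != 0 -> mono c x y z.
Proof.
apply: contraNT => m; rewrite /wt big1 ?ofZ0 // => u _; rewrite big1 // => v _.
by rewrite big1 // => w _; rewrite /lam (negbTE m).
Qed.

Lemma wtC12 x y z : wt y x z = wt x y z.
Proof.
by rewrite /wt; do 3![congr ofZ || (apply: eq_bigr => ? _)]; apply: eq_bigr => ? _; rewrite lamC12.
Qed.

Lemma wtC23 x y z : wt x z y = wt x y z.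
Proof.
by rewrite /wt; do 3![congr ofZ || (apply: eq_bigr => ? _)]; apply: eq_bigr => ? _; rewrite lamC23.
Qed.

(** Weights are of order [n ^+ 3] against a normalisation of order [n ^+ 4], so normalised weights
    become arbitrarily small, as the nibble requires. *)
Lemma wt_le x y z : wt x y z <= ofZ lam_max * n%:R ^+ 3.
Proof.
have : \sum_u \sum_v \sum_w lam c x y z u v w <= lam_max *+ (n ^ 3).
  rewrite !expnS muln1 !mulrnA -3!sumr_const.
  by do 3![apply: ler_sum => ? _]; exact: lam_le.
by move/ofZ_le; rewrite ofZ_mulrn -(mulr_natr (ofZ _)) natrX.
Qed.

Lemma wt_load x y : \sum_z wt x y z <= 2%:R * ofZ scale * n%:R ^+ 4.
Proof.
have := ofZ_le (lam_load_le csym x y).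
move: scale => k; have -> : 2 * k = k *+ 2 by lia.
by rewrite ofZ_sum !ofZ_mulrn -(mulr_natr (_ *+ _)) natrX mulr_natl.
Qed.

Lemma wt_total : ofZ scale * n%:R ^+ 6 +
    ofZ gain * n%:R * (\sum_x \sum_y \sum_z \sum_u \sum_v (bad c x y z u v)%:R) <=
  \sum_x \sum_y \sum_z wt x y z.
Proof.
have := ofZ_le (lam_total_ge csym).
rewrite ofZD ofZ_mulrn -(mulr_natr (ofZ _)) natrX => h.
have -> : \sum_x \sum_y \sum_z wt x y z =
   ofZ (\sum_x \sum_y \sum_z \sum_u \sum_v \sum_w lam c x y z u v w).
  by do 3![rewrite ofZ_sum; apply: eq_bigr => ? _].
apply: le_trans h; rewrite lerD2l mulr_sumr ofZ_sum; apply: ler_sum => x _.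
rewrite mulr_sumr ofZ_sum; apply: ler_sum => y _.
rewrite mulr_sumr ofZ_sum; apply: ler_sum => z _.
rewrite mulr_sumr ofZ_sum; apply: ler_sum => u _.
rewrite mulr_sumr ofZ_sum; apply: ler_sum => v _.
by rewrite ofZ_sum sumr_const ofZ_mulrn mulr_natr -mulrnAl mulr_natr mulrnAC.
Qed.
End Weights.

(** * Weights of triples and edge-disjoint triangles *)

Section SetWeights.
Variables (R : realFieldType) (V : finType) (f : V -> V -> V -> R).
Hypothesis f_ge0 : forall x y z, 0 <= f x y z.
Hypothesis fC12 : forall x y z, f y x z = f x y z.
Hypothesis fC23 : forall x y z, f x z y = f x y z.

Definition distinct3 (x y z : V) : bool := [&& x != y, x != z & y != z].

(** An arbitrary order of the three vertices is picked; by the symmetry of [f] the choice does not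
    matter. *)
Definition set_weight (T : {set V}) : R :=
  if [pick p : V * V * V | (T == [set p.1.1; p.1.2; p.2]) && distinct3 p.1.1 p.1.2 p.2] is Some p
  then f p.1.1 p.1.2 p.2 else 0.

Lemma set_weightE x y z : distinct3 x y z -> set_weight [set x; y; z] = f x y z.
Proof.
move=> dxyz; rewrite /set_weight; case: pickP => [[[a b] d]|/(_ (x, y, z))] /=; last first.
  by rewrite eqxx dxyz.
move=> /andP[/eqP E /and3P[ab ad bd]].
have: a \in [set x; y; z] by rewrite E !inE eqxx.
have: b \in [set x; y; z] by rewrite E !inE eqxx orbT.
have: d \in [set x; y; z] by rewrite E !inE eqxx !orbT.
have f13 u v w : f w v u = f u v w by rewrite fC12 fC23 fC12.
rewrite !inE => /orP[/orP[]|]/eqP dE /orP[/orP[]|]/eqP bE /orP[/orP[]|]/eqP aE;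
  move: ab ad bd; rewrite dE bE aE ?eqxx //= => _ _ _;
  solve [exact: f13 | by rewrite fC23 fC12 | by rewrite fC12 fC23
        | by rewrite fC23 | by rewrite fC12].
Qed.

Lemma set_weight_ge0 T : 0 <= set_weight T.
Proof. by rewrite /set_weight; case: pickP. Qed.

Lemma card3P (T : {set V}) x y : #|T| = 3%N -> x \in T -> y \in T -> x != y ->
  exists2 z, T = [set x; y; z] & distinct3 x y z.
Proof.
move=> T3 xT yT xy.
have : #|T :\ x :\ y| == 1%N.
  by move: T3; rewrite (cardsD1 x) xT (cardsD1 y) !inE eq_sym xy yT !add1n => -[->].
case/cards1P => z E.
have : z \in T :\ x :\ y by rewrite E set11.
rewrite !inE => /and3P[zy zx zT]; exists z; last first.
  by rewrite /distinct3 xy eq_sym zx eq_sym zy.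
apply/setP => t; rewrite !inE; have := congr1 (fun A : {set V} => t \in A) E.
rewrite !inE; case: eqP => [->|_]; case: eqP => [->|_] //=; rewrite ?xT ?yT ?orbT //.
Qed.

Lemma set_weight_n0 T : set_weight T != 0 ->
  exists x y z, [/\ T = [set x; y; z], distinct3 x y z & f x y z != 0].
Proof.
rewrite /set_weight; case: pickP => [[[x y] z] /= /andP[/eqP-> d] h|]; last by rewrite eqxx.
by exists x, y, z.
Qed.

Lemma card_set3 x y z : distinct3 x y z -> #|[set x; y; z]| = 3%N.
Proof.
by case/and3P => xy xz yz; rewrite setUC cardsU1 !inE cards2 xy negb_or eq_sym xz eq_sym yz.
Qed.

Lemma set_weight_load x y : x != y ->
  \sum_(T : {set V} | [&& #|T| == 3%N, x \in T & y \in T]) set_weight T =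
  \sum_(z | distinct3 x y z) f x y z.
Proof.
move=> xy; pose h z := [set x; y; z].
rewrite (eq_bigr (fun z => set_weight (h z))); last by move=> z d; rewrite set_weightE.
rewrite (eq_bigl (mem [set z | distinct3 x y z])) => [|z]; last by rewrite !inE.
rewrite -[RHS](big_imset (h := h) set_weight) => [|z t] /=; last first.
  rewrite !inE => /and3P[_ xz yz] _ E; have : z \in h t by rewrite -E !inE eqxx orbT.
  by rewrite !inE eq_sym (negbTE xz) eq_sym (negbTE yz) => /eqP.
apply: eq_bigl => T; apply/and3P/imsetP => [[/eqP T3 xT yT]|[z]].
  by have [z -> d] := card3P T3 xT yT xy; exists z; rewrite ?inE.
by rewrite inE => d ->; rewrite card_set3 // !inE !eqxx orbT.
Qed.

(** A triple arises from six ordered pairs [x y], each of which determines [z]. *)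
Lemma set_weight_sum :
  \sum_(T : {set V} | #|T| == 3%N) set_weight T * 6%:R =
  \sum_x \sum_(y | x != y) \sum_(z | distinct3 x y z) f x y z.
Proof.
rewrite (eq_bigr (fun x => \sum_(y | x != y)
   \sum_(T : {set V} | [&& #|T| == 3%N, x \in T & y \in T]) set_weight T)); last first.
  by move=> x _; apply: eq_bigr => y xy; rewrite set_weight_load.
rewrite (eq_bigr (fun x => \sum_(T : {set V} | #|T| == 3%N) \sum_(y | x != y)
   (if (x \in T) && (y \in T) then set_weight T else 0))); last first.
  move=> x _; rewrite exchange_big; apply: eq_bigr => y _.
  by rewrite -big_mkcondr.
rewrite exchange_big; apply: eq_bigr => T /eqP T3 /=.
rewrite (eq_bigr (fun x => if x \in T then set_weight T * 2%:R else 0)); last first.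
  move=> x _; case: ifP => xT /=; last by rewrite big1.
  rewrite -big_mkcondr (eq_bigl (mem (T :\ x))); last by move=> y; rewrite !inE eq_sym.
  rewrite sumr_const mulr_natr; congr (_ *+ _).
  by move: T3; rewrite (cardsD1 x) xT add1n => -[].
by rewrite -big_mkcond sumr_const T3; ring.
Qed.
End SetWeights.

Lemma card_edges_of (V : finType) (t : {set V}) : #|edges_of t| = 'C(#|t|, 2).
Proof. by rewrite -cards_draws; apply: eq_card => e; rewrite !inE. Qed.

Lemma mem_edges_of (V : finType) (t e : {set V}) :
  (e \in edges_of t) = (e \subset t) && (#|e| == 2%N).
Proof. by rewrite !inE. Qed.

Lemma edges_ofI (V : finType) (t t' : {set V}) :
  edges_of t :&: edges_of t' = edges_of (t :&: t').
Proof.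
by apply/setP => e; rewrite inE !mem_edges_of subsetI; case: (e \subset t); case: (e \subset t');
  case: (_ == _).
Qed.

Lemma edges_of_inj (V : finType) (t t' : {set V}) : (1 < #|t|)%N ->
  edges_of t = edges_of t' -> t \subset t'.
Proof.
move=> t2 E; apply/subsetP => x xt.
have [y] : exists y, y \in t :\ x.
  by apply/set0Pn; rewrite -card_gt0; move: t2; rewrite (cardsD1 x) xt.
rewrite !inE => /andP[yx yt].
have : [set x; y] \in edges_of t'.
  by rewrite -E mem_edges_of cards2 (eq_sym x) yx subUset !sub1set xt yt.
by rewrite mem_edges_of subUset sub1set => /andP[/andP[]].
Qed.

(** [nibble] is applied to the hypergraph whose vertices are the edges of the complete graph and
    whose hyperedges are the sets [edges_of T]. It is linear because distinct triangles share at
    most two vertices, hence at most one edge. *)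
Lemma triangle_packing (R : archiRealFieldType) (delta : R) : 0 < delta ->
  exists2 eta : R, 0 < eta & forall (V : finType) (W : {set V} -> R),
  (forall T, 0 <= W T <= eta) -> (forall T, W T != 0 -> #|T| = 3%N) ->
  (forall e : {set V}, #|e| = 2%N -> \sum_(T : {set V} | e \subset T) W T <= 1) ->
  exists Tr : {set {set V}}, [/\ forall T, T \in Tr -> W T != 0,
    forall T T', T \in Tr -> T' \in Tr -> T != T' -> edge_disjoint T T'
  & \sum_(T : {set V}) W T <= #|Tr|%:R + delta * #|V|%:R ^+ 2].
Proof.
move=> d0; have [eta e0 H] := nibble d0; exists eta => // V W Weta W3 Wload.
have inj T T' : W T != 0 -> W T' != 0 -> edges_of T = edges_of T' -> T = T'.
  move=> /W3 T3 /W3 T'3 E; apply/eqP; rewrite eqEsubset.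
  by rewrite !edges_of_inj ?T3 ?T'3.
(* Since [edges_of] is injective on the support of [W], at most one term of this sum is nonzero. *)
pose w (K : {set {set V}}) := \sum_(T : {set V} | edges_of T == K) W T.
have wE T : W T != 0 -> w (edges_of T) = W T.
  move=> WT; rewrite /w (bigD1 T) //= big1 ?addr0 // => T' /andP[/eqP E TT'].
  apply/eqP; apply: contraNT TT' => WT'; by rewrite (inj _ _ WT' WT E).
have w_n0 K : w K != 0 -> exists2 T, W T != 0 & K = edges_of T.
  move=> wK; case: (pickP (fun T : {set V} => (edges_of T == K) && (W T != 0))) => [T|no].
    by move=> /andP[/eqP <- WT]; exists T.
  case/eqP: wK; rewrite /w big1 // => T E; apply/eqP.
  by have := no T; rewrite E /= => /negbFE.
pose A := [set e : {set V} | #|e| == 2%N].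
have wP : frac_matching eta A w.
  split.
  - move=> K; have [->|wK] := eqVneq (w K) 0; first by rewrite lexx ltW.
    by have [T WT ->] := w_n0 _ wK; rewrite wE.
  - move=> K /w_n0[T WT ->]; rewrite card_edges_of W3 //; split=> //.
    by apply/subsetP => e; rewrite mem_edges_of inE => /andP[].
  - move=> K K' /w_n0[T WT ->] /w_n0[T' WT' ->] KK'.
    rewrite edges_ofI card_edges_of.
    have : (#|T :&: T'| <= 2)%N.
      rewrite -ltnS -[3%N in X in (_ < X)%N](W3 _ WT) proper_card // properEneq subsetIl andbT.
      apply: contraNneq KK' => /setIidPl TT'.
      suff -> : T = T' by [].
      by apply/eqP; rewrite eqEcard TT' (W3 _ WT) (W3 _ WT').
    by case: #|_| => [|[|[|k]]].
  - move=> e; rewrite /w (exchange_big_dep predT) //=.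
    rewrite (eq_bigr (fun T => if e \in edges_of T then W T else 0)); last first.
      move=> T _; case: ifP => eT; last first.
        by rewrite big1 // => K /andP[eK /eqP E]; rewrite -E eT in eK.
      rewrite (big_pred1 (edges_of T)) // => K; rewrite eq_sym /=.
      by case: eqP => [->|]; rewrite ?eT ?andbF.
    rewrite -big_mkcond; have [e2|e2] := eqVneq #|e| 2%N.
      rewrite (eq_bigl (fun T : {set V} => e \subset T)); first exact: Wload.
      by move=> T; rewrite mem_edges_of e2 eqxx andbT.
    by rewrite big_pred0 // => T; rewrite mem_edges_of (negbTE e2) andbF.
have [M [M1 M2 M3]] := H _ A w wP.
pose Tr := [set T : {set V} | (W T != 0) && (edges_of T \in M)].
exists Tr; split.
- by move=> T; rewrite inE => /andP[].
- move=> T T'; rewrite !inE => /andP[WT TM] /andP[WT' TM'] TT'; apply: M2 => //.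
  by apply: contraNneq TT' => /(inj _ _ WT WT') ->.
have -> : \sum_(T : {set V}) W T = \sum_K w K.
  rewrite /w (exchange_big_dep predT) //=; apply: eq_bigr => T _.
  by rewrite (big_pred1 (edges_of T)) // => K; rewrite eq_sym.
apply: le_trans M3 _; apply: lerD.
  rewrite ler_nat; apply: leq_trans (leq_imset_card (@edges_of V) Tr).
  apply/subset_leq_card/subsetP => K KM.
  have [T WT E] := w_n0 _ (M1 _ KM); apply/imsetP; exists T => //.
  by rewrite inE WT -E.
rewrite ler_wpM2l ?(ltW d0) // -natrX ler_nat /A card_draws.
rewrite bin2 leq_half_double -addnn -mulnn leqW // (leq_trans _ (leq_addr _ _)) //.
by rewrite leq_mul2l leq_pred orbT.
Qed.

(** * Colourings far from bipartite *)

Section Stability.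
Variables (R : realType) (V : finType) (c : {set V} -> bool).

Definition color (x y : V) : bool := c [set x; y].

Lemma colorC x y : color x y = color y x.
Proof. by rewrite /color setUC. Qed.

Lemma mono_triangleP x y z :
  distinct3 x y z -> mono color x y z -> mono_triangle c [set x; y; z].
Proof.
move=> d /andP[xz yz].
have {}xz : color x z = color x y by case: (color x z) (color x y) xz => [] [].
have {}yz : color y z = color x y by case: (color y z) (color x y) yz => [] [].
have cE e : e \in edges_of [set x; y; z] -> c e = color x y.
  rewrite mem_edges_of andbC => /andP[/cards2P[u [v [uv ->]]]].
  rewrite subUset !sub1set !inE -[c _]/(color u v) => /andP[].
  move=> /orP[/orP[]|]/eqP uE /orP[/orP[]|]/eqP vE;
    move: uv; rewrite uE vE ?eqxx // => _;
    solve [by [] | by rewrite colorC | by rewrite xz | by rewrite colorC xz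
          | by rewrite yz | by rewrite colorC yz].
rewrite /mono_triangle card_set3 //=; apply/orP; case: (boolP (color x y)) => b.
  by left; apply/forall_inP => e /cE ->.
by right; apply/forall_inP => e /cE ->.
Qed.

Definition side (x y z u : V) : bool := (1 < agree color (color x y) x y z u)%N.

(** Deleting the edges of the opposite colour inside the two classes of [side] makes that colour
    bipartite. Hence there are more than [k] such edges, and each yields a bad pair. *)
Lemma far_bad (k : R) x y z :
  far_from_bipartite k (red_graph c) -> far_from_bipartite k (blue_graph c) ->
  mono color x y z -> k <= \sum_u \sum_v (bad color x y z u v)%:R.
Proof.
move=> far_red far_blue m; pose b := color x y.
pose E := [set e : {set V} | (#|e| == 2%N) && (c e (+) b)].
have farE : far_from_bipartite k E.
  have -> : E = if b then blue_graph c else red_graph c.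
    by apply/setP => e; rewrite inE; case: (b); rewrite inE ?addbT ?addbF.
  by case: (b).
pose cut (e : {set V}) := [forall u in e, forall v in e, (u != v) ==> (side x y z u != side x y z v)].
pose F := [set e in E | cut e].
pose P := [set p : V * V | bad color x y z p.1 p.2].
have FE : E :\: F \subset [set [set p.1; p.2] | p in P].
  apply/subsetP => e; rewrite !inE => /andP[+ /andP[e2 ce]]; rewrite e2 ce /=.
  rewrite negb_forall_in => /exists_inP[u ue].
  rewrite negb_forall_in => /exists_inP[v ve]; rewrite negb_imply negbK => /andP[uv suv].
  have eE : e = [set u; v].
    apply/esym/eqP; rewrite eqEcard (eqP e2) cards2 uv andbT.
    by apply/subsetP => t /set2P[] ->.
  apply/imsetP; exists (u, v) => //; rewrite inE /bad m /=.
  by rewrite -[(_ < _)%N]/(side x y z u) -[X in _ == X]/(side x y z v) suv /color -eE.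
have : k < #|E :\: F|%:R.
  rewrite ltNge; apply/negP => h; apply: farE; exists F; split=> //.
    by apply/subsetP => e; rewrite inE => /andP[].
  exists (side x y z) => e; rewrite inE => /andP[_ /forall_inP he] u v ue ve uv.
  by have /forall_inP/(_ v ve)/implyP/(_ uv) := he u ue.
move/ltW/le_trans; apply.
rewrite pair_bigA /= -natr_sum ler_nat.
apply: leq_trans (subset_leq_card FE) (leq_trans (leq_imset_card _ _) _).
rewrite -sum1_card big_mkcond /=; apply: leq_sum => p _.
by rewrite inE; case: (bad _ _ _ _ _ _).
Qed.
End Stability.

(** Each of the three coincidences holds for [#|V| ^ 2] triples. *)
Lemma sum_coincidences (R : comNzRingType) (V : finType) (k : R) :
  \sum_(x : V) \sum_(y : V) \sum_(z : V) ((x == y)%:R * k + (x == z)%:R * k + (y == z)%:R * k) =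
  3%:R * #|V|%:R ^+ 2 * k.
Proof.
have d1 (x : V) : \sum_y (x == y)%:R * k = k.
  rewrite (bigD1 x) //= eqxx mul1r big1 ?addr0 // => y; rewrite eq_sym => /negbTE ->.
  by rewrite mul0r.
have cst (a : R) : \sum_(x : V) a = #|V|%:R * a by rewrite sumr_const mulr_natl.
rewrite (eq_bigr (fun=> 3%:R * #|V|%:R * k)) => [|x _].
  by rewrite cst; move: (#|V|%:R) => m; ring.
rewrite (eq_bigr (fun y => (#|V|%:R * ((x == y)%:R * k) + k) + k)) => [|y _].
  rewrite !big_split /= -mulr_sumr d1 cst; move: (#|V|%:R) => m; ring.
by rewrite !big_split /= cst !d1.
Qed.

(** * Total weight of the triangles *)

Section Total.
Variables (R : realType) (V : finType) (c : {set V} -> bool) (eps : R).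
Let m : R := #|V|%:R.
Let s : R := ofZ R scale.
Let g : R := ofZ R gain.
Let B : R := ofZ R lam_max.

Lemma ofZ_gt0 z : 0 < z -> 0 < ofZ R z.
Proof. by move=> z0; rewrite ofZE ltr0z; lia. Qed.

Lemma scale_gt0 : 0 < s. Proof. by apply: ofZ_gt0; vm_compute. Qed.
Lemma gain_gt0 : 0 < g. Proof. by apply: ofZ_gt0; vm_compute. Qed.
Lemma lam_max_gt0 : 0 < B. Proof. by apply: ofZ_gt0; vm_compute. Qed.

Let f := wt R (@color V c).

(** The total weight is at least [s * m ^+ 6], and a monochromatic triple carries at most
    [B * m ^+ 3] of it. *)
Lemma mono_count : 0 < m -> s / B * m ^+ 3 <= \sum_x \sum_y \sum_z (mono (color c) x y z)%:R.
Proof.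
move=> m0; have B0 := lam_max_gt0; have s0 := scale_gt0; have g0 := gain_gt0.
have h := wt_total R (@colorC V c).
have h1 : \sum_x \sum_y \sum_z f x y z <=
    B * m ^+ 3 * \sum_x \sum_y \sum_z (mono (color c) x y z)%:R.
  rewrite mulr_sumr; apply: ler_sum => x _; rewrite mulr_sumr; apply: ler_sum => y _.
  rewrite mulr_sumr; apply: ler_sum => z _.
  have [f0|/wt_mono ->] := eqVneq (f x y z) 0; last by rewrite mulr1 wt_le.
  by rewrite f0 !mulr_ge0 ?exprn_ge0 ?ler0n ?(ltW B0) ?(ltW m0).
have bad_ge0 : 0 <= \sum_x \sum_y \sum_z \sum_u \sum_v (bad (color c) x y z u v)%:R :> R.
  by do 5![apply: sumr_ge0 => ? _]; rewrite ler0n.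
have h2 : 0 <= g * m * \sum_x \sum_y \sum_z \sum_u \sum_v (bad (color c) x y z u v)%:R.
  by rewrite !mulr_ge0 // ltW.
have h3 : s * m ^+ 6 <= B * m ^+ 3 * \sum_x \sum_y \sum_z (mono (color c) x y z)%:R.
  by apply: le_trans h1; apply: le_trans h; rewrite lerDl.
rewrite mulrAC ler_pdivrMr // -(ler_pM2l (exprn_gt0 3 m0)).
have -> : m ^+ 3 * (s * m ^+ 3) = s * m ^+ 6 by ring.
by apply: le_trans h3 _; rewrite le_eqVlt; apply/orP; left; apply/eqP; ring.
Qed.

(** At most [3 * m ^+ 2] ordered triples repeat a vertex, each of weight at most [B * m ^+ 3]. *)
Lemma sum_distinct_ge : \sum_x \sum_y \sum_z f x y z - 3%:R * B * m ^+ 5 <=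
  \sum_x \sum_(y | x != y) \sum_(z | distinct3 x y z) f x y z.
Proof.
have B0 := lam_max_gt0; rewrite lerBlDr.
pose k : R := B * m ^+ 3; have k0 : 0 <= k by rewrite mulr_ge0 ?exprn_ge0 ?ler0n ?(ltW B0).
have -> : 3%:R * B * m ^+ 5 = 3%:R * m ^+ 2 * k.
  by rewrite /k; move: B m => B' m'; ring.
rewrite -sum_coincidences.
rewrite -big_split; apply: ler_sum => x _ /=; rewrite [X in _ <= X + _]big_mkcond -big_split.
apply: ler_sum => y _ /=; rewrite [X in _ <= X + _](_ : _ =
    \sum_z (if distinct3 x y z then f x y z else 0)); last first.
  rewrite -big_mkcond; case: ifP => // /negbFE/eqP ->.
  by rewrite big_pred0 // => z; rewrite /distinct3 eqxx.
rewrite -big_split; apply: ler_sum => z _ /=; rewrite /distinct3.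
have fk : f x y z <= k by exact: wt_le.
have f0 : 0 <= f x y z by exact: wt_ge0.
by case: (x == y); case: (x == z); case: (y == z); rewrite /= ?mul1r ?mul0r; lra.
Qed.

(** By [far_bad], each of the monochromatic triples counted in [mono_count] yields at least
    [eps * m ^+ 2] bad pairs, which [wt_total] turns into surplus weight. The last term on the left
    is the loss from repeated vertices. *)
Lemma set_weight_total :
  0 < m -> 0 <= eps ->
  far_from_bipartite (eps * m ^+ 2) (red_graph c) ->
  far_from_bipartite (eps * m ^+ 2) (blue_graph c) ->
  m ^+ 2 / 12%:R + g * eps / (12%:R * B) * m ^+ 2 - B / (4%:R * s) * m <=
  \sum_(T : {set V} | #|T| == 3%N) set_weight f T / (2%:R * s * m ^+ 4).
Proof.
move=> m0 eps0 far_red far_blue.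
have B0 := lam_max_gt0; have s0 := scale_gt0; have g0 := gain_gt0.
have fC12 := wtC12 R (@colorC V c); have fC23 := wtC23 R (@colorC V c).
have h1 := set_weight_sum (f := f) fC12 fC23.
have h2 := sum_distinct_ge; have h3 := wt_total R (@colorC V c).
have h4 : eps * m ^+ 2 * (s / B * m ^+ 3) <=
    \sum_x \sum_y \sum_z \sum_u \sum_v (bad (color c) x y z u v)%:R.
  apply: (@le_trans _ _ (eps * m ^+ 2 * \sum_x \sum_y \sum_z (mono (color c) x y z)%:R)).
    by rewrite ler_wpM2l ?mono_count // mulr_ge0 // exprn_ge0 // ltW.
  rewrite mulr_sumr; apply: ler_sum => x _; rewrite mulr_sumr; apply: ler_sum => y _.
  rewrite mulr_sumr; apply: ler_sum => z _.
  case: (boolP (mono (color c) x y z)) => [mxyz|_]; first by rewrite mulr1 far_bad.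
  by rewrite mulr0; do 2![apply: sumr_ge0 => ? _]; rewrite ler0n.
have h5 : g * m * (eps * m ^+ 2 * (s / B * m ^+ 3)) <=
    g * m * \sum_x \sum_y \sum_z \sum_u \sum_v (bad (color c) x y z u v)%:R.
  by rewrite ler_wpM2l // mulr_ge0 // ltW.
rewrite -mulr_suml ler_pdivlMr ?mulr_gt0 ?exprn_gt0 // -(ler_pM2r (_ : 0 < 6%:R :> R)) //.
rewrite -mulr_suml in h1; rewrite h1; apply: le_trans h2.
move: h3; rewrite -/f -/m -/s -/g; set X := \sum_x \sum_y \sum_z f x y z.
move: h5; set Y := g * m * (\sum_x _) => h5 h3.
have -> : (m ^+ 2 / 12%:R + g * eps / (12%:R * B) * m ^+ 2 - B / (4%:R * s) * m) *
    (2%:R * s * m ^+ 4) * 6%:R =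
    s * m ^+ 6 + g * m * (eps * m ^+ 2 * (s / B * m ^+ 3)) - 3%:R * B * m ^+ 5.
  by field; rewrite !gt_eqF.
by lra.
Qed.
End Total.

Lemma set_weight_le (R : realFieldType) (V : finType) (f : V -> V -> V -> R) (M : R) T :
  0 <= M -> (forall x y z, f x y z <= M) -> set_weight f T <= M.
Proof. by move=> M0 fM; rewrite /set_weight; case: pickP. Qed.

Theorem theorem1p3 (R : realType) (eps : R) : 0 < eps ->
  exists delta : R, 0 < delta /\
  exists N : nat, forall n : nat, (N <= n)%N ->
  forall c : {set 'I_n} -> bool,
    far_from_bipartite (eps * (n%:R ^+ 2)) (red_graph c) ->
    far_from_bipartite (eps * (n%:R ^+ 2)) (blue_graph c) ->
    exists Tr : {set {set 'I_n}},
      [/\ (forall t, t \in Tr -> mono_triangle c t),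
          (forall t1 t2, t1 \in Tr -> t2 \in Tr -> t1 != t2 -> edge_disjoint t1 t2)
        & (n%:R ^+ 2) / 12%:R + delta * (n%:R ^+ 2) <= #|Tr|%:R].
Proof.
move=> eps0; have B0 := lam_max_gt0 R; have s0 := scale_gt0 R; have g0 := gain_gt0 R.
have total := set_weight_total.
move: (ofZ R gain) g0 (@total R) => g g0 {}total.
(* The surplus coefficient of [set_weight_total]: a quarter pays for the packing, a quarter for the
   repeated vertices, and the rest is [delta]. *)
pose d0 := g * eps / (12%:R * ofZ R lam_max).
have d0_gt0 : 0 < d0 by rewrite divr_gt0 ?mulr_gt0.
exists (d0 / 2%:R); split; first by rewrite divr_gt0.
have d4 : 0 < d0 / 4%:R by rewrite divr_gt0.
have [eta eta0 packing] := triangle_packing d4.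
(* For [n] above the first summand the normalised weights are at most [eta]; above the second, the
   linear error is at most [d0 / 4 * n ^+ 2]. *)
pose X := ofZ R lam_max / (2%:R * ofZ R scale * eta) + ofZ R lam_max / (ofZ R scale * d0).
exists (Num.truncn X).+1 => n nN c far_red far_blue.
have Xn : X < n%:R.
  by apply: lt_le_trans (truncnS_gt X) _; rewrite ler_nat.
have X1 : 0 < ofZ R lam_max / (2%:R * ofZ R scale * eta).
  by apply: divr_gt0 B0 _; rewrite !mulr_gt0.
have X2 : 0 < ofZ R lam_max / (ofZ R scale * d0).
  by apply: divr_gt0 B0 _; rewrite mulr_gt0.
have m0 : 0 < n%:R :> R by apply: lt_trans Xn; rewrite addr_gt0.
have h1 : ofZ R lam_max / (2%:R * ofZ R scale * eta) <= n%:R.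
  by apply: ltW; apply: le_lt_trans Xn; rewrite lerDl ltW.
have h2 : ofZ R lam_max / (ofZ R scale * d0) <= n%:R.
  by apply: ltW; apply: le_lt_trans Xn; rewrite lerDr ltW.
pose f := wt R (color c); pose k : R := 2%:R * ofZ R scale * n%:R ^+ 4.
have k0 : 0 < k by rewrite !mulr_gt0 ?exprn_gt0.
have fC12 := wtC12 R (@colorC _ c); have fC23 := wtC23 R (@colorC _ c).
have f0 := wt_ge0 R (color c).
pose W (T : {set 'I_n}) := set_weight f T / k.
have W_n0 T : W T != 0 ->
    exists x y z, [/\ T = [set x; y; z], distinct3 x y z & f x y z != 0].
  move=> WT; apply: set_weight_n0; apply: contraNneq WT => T0.
  by rewrite /W T0 mul0r.
have W3 T : W T != 0 -> #|T| = 3%N by move=> /W_n0[x [y [z [-> d _]]]]; apply: card_set3.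
have [||e e2|Tr [Tr1 Tr2 Tr3]] := packing _ W.
- move=> T; rewrite /W divr_ge0 ?(ltW k0) ?set_weight_ge0 //= ler_pdivrMr //.
  apply: (@le_trans _ _ (ofZ R lam_max * n%:R ^+ 3)).
    apply: set_weight_le => [|x y z].
      by rewrite mulr_ge0 ?exprn_ge0 ?(ltW B0) ?(ltW m0).
    by have := wt_le R (color c) x y z; rewrite card_ord.
  rewrite /k (exprS _ 3); rewrite ler_pdivrMr ?mulr_gt0 // in h1.
  have -> : eta * (2%:R * ofZ R scale * (n%:R * n%:R ^+ 3)) =
    n%:R * (2%:R * ofZ R scale * eta) * n%:R ^+ 3 by move: (ofZ R scale) => s; ring.
  by apply: (ler_wpM2r _ h1); rewrite exprn_ge0 ?(ltW m0).
- exact: W3.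
- have /cards2P[x [y [xy eE]]] : #|e| == 2%N by rewrite e2.
  rewrite -mulr_suml ler_pdivrMr // mul1r.
  apply: (@le_trans _ _ (\sum_(z | distinct3 x y z) f x y z)).
    rewrite -(set_weight_load fC12 fC23 xy) big_mkcond [leRHS]big_mkcond.
    apply: ler_sum => T _; rewrite eE subUset !sub1set.
    case: ((x \in T) && (y \in T)); rewrite ?andbF // andbT; case: eqP => // T3.
    case: (eqVneq (W T) 0) => [/eqP|/W3 //].
    by rewrite mulf_eq0 invr_eq0 (gt_eqF k0) orbF => /eqP ->.
  apply: le_trans (_ : \sum_z f x y z <= _).
    by rewrite big_mkcond; apply: ler_sum => z _; case: ifP => _; rewrite ?lexx ?f0.
  by have := wt_load R (@colorC _ c) x y; rewrite card_ord.
exists Tr; split=> //.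
  by move=> t /Tr1/W_n0[x [y [z [-> d /wt_mono]]]]; apply: mono_triangleP.
have := total _ c eps; rewrite card_ord => /(_ m0 (ltW eps0) far_red far_blue).
rewrite -/d0 -/f -/k => h3.
have h4 : \sum_(T : {set 'I_n} | #|T| == 3%N) set_weight f T / k <= \sum_(T : {set 'I_n}) W T.
  rewrite big_mkcond; apply: ler_sum => T _; case: ifP => // _.
  by rewrite divr_ge0 ?(ltW k0) ?set_weight_ge0.
rewrite card_ord in Tr3.
have h5 : ofZ R lam_max / (4%:R * ofZ R scale) * n%:R <= d0 / 4%:R * n%:R ^+ 2.
  rewrite expr2 mulrA ler_wpM2r ?(ltW m0) //.
  have sd0 : 0 < ofZ R scale * d0 by rewrite mulr_gt0.
  have s40 : 0 < 4%:R * ofZ R scale by rewrite mulr_gt0.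
  move: h2; rewrite (ler_pdivrMr _ _ sd0) (ler_pdivrMr _ _ s40) => h2.
  have -> : d0 / 4%:R * n%:R * (4%:R * ofZ R scale) = n%:R * (ofZ R scale * d0).
    by move: (ofZ R scale) (d0) => s d; field.
  exact: h2.
move: (ofZ R lam_max / _ * _) h3 h5 => Y h3 h5.
by move: (d0) h3 h5 Tr3 => d h3 h5 Tr3; lra.
Qed.
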